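(* Let $\Omega\subset\mathbb{R}^n$ be a bounded open convex set with smooth boundary, and let $\Lambda\ge 0$. If problem $(N_\Lambda)$ admits a nonconstant continuous viscosity solution $u$ on $\overline\Omega$, then $$\Lambda\ \ge\ \Lambda_\infty(\Omega):=\frac{2}{\operatorname{diam}(\Omega)} .$$ Moreover, for $\Lambda=\frac{2}{\operatorname{diam}(\Omega)}$ problem $(N_\Lambda)$ admits a nonconstant Lipschitz continuous viscosity solution.
   Context: $\operatorname{diam}(\Omega)=\sup_{x,y\in\Omega}|x-y|$ is the Euclidean diameter. $\nu$ denotes the outer unit normal to $\partial\Omega$, and $\Delta_\infty u=\sum_{i,j=1}^n u_{x_i}u_{x_ix_j}u_{x_j}$. For $\Lambda\ge 0$, problem $(N_\Lambda)$ is $$\min\{|\nabla u|-\Lambda|u|,-\Delta_\infty u\}=0 \text{ in }\{u>0\}\cap\Omega,\quad \max\{\Lambda|u|-|\nabla u|,-\Delta_\infty u\}=0 \text{ in }\{u<0\}\cap\Omega,\quad -\Delta_\infty u=0 \text{ in }\{u=0\}\cap\Omega,\quad \tfrac{\partial u}{\partial\nu}=0 \text{ on }\partial\Omega,$$ understood in the viscosity sense as follows. For $s\in\mathbb{R}$, $\xi\in\mathbb{R}^n$, $X$ a symmetric $n\times n$ matrix, let $F(s,\xi,X)=\min\{|\xi|-\Lambda|s|,-\langle X\xi,\xi\rangle\}$, $G(s,\xi,X)=\max\{\Lambda|s|-|\xi|,-\langle X\xi,\xi\rangle\}$, $H(X)=-\langle X\xi,\xi\rangle$ (evaluated at the same $\xi$).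 For a function $u$ and point $x_0$, let $E$ denote $F$ if $u(x_0)>0$, $G$ if $u(x_0)<0$, $H$ if $u(x_0)=0$. An upper semicontinuous $u$ on $\overline\Omega$ is a viscosity subsolution if: for every $x_0\in\Omega$ and $\phi\in C^2(\Omega)$ with $\phi(x_0)=u(x_0)$ and $u(x)<\phi(x)$ for $x\neq x_0$, one has $E(\phi(x_0),\nabla\phi(x_0),\nabla^2\phi(x_0))\le 0$; and for every $x_0\in\partial\Omega$ and $\phi\in C^2(\overline\Omega)$ with the same touching property, $\min\{E(\phi(x_0),\nabla\phi(x_0),\nabla^2\phi(x_0)),\frac{\partial\phi}{\partial\nu}(x_0)\}\le 0$. A lower semicontinuous $u$ is a viscosity supersolution if the same holds with $u(x)>\phi(x)$ for $x\ne x_0$, with ''$E\le 0$'' replaced by ''$E\ge 0$'' at interior points and with $\max\{E(\phi(x_0),\nabla\phi(x_0),\nabla^2\phi(x_0)),\frac{\partial\phi}{\partial\nu}(x_0)\}\ge 0$ at boundary points. A continuous $u$ is a viscosity solution if it is both a sub- and a supersolution. *)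

(* Defs.v *)
(* classical real numbers. R^n is modelled as the set of
   sequences x : nat -> R vanishing at all indices >= n. *)
From Stdlib Require Import Reals Lra ClassicalEpsilon.
Open Scope R_scope.

Definition pt := nat -> R.

Fixpoint sumR (n : nat) (f : nat -> R) : R :=
  match n with O => 0 | S k => sumR k f + f k end.

Definition InRn (n : nat) (x : pt) : Prop := forall i, (n <= i)%nat -> x i = 0.

Definition norm_n (n : nat) (x : pt) : R := sqrt (sumR n (fun i => x i ^ 2)).
Definition dist_n (n : nat) (x y : pt) : R := norm_n n (fun i => x i - y i).

Definition evec (i : nat) : pt := fun j => if Nat.eqb j i then 1 else 0.

Definition open_set_n (n : nat) (U : pt -> Prop) : Prop :=
  (forall x, U x -> InRn n x) /\
  forall x, U x -> exists r, 0 < r /\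
     forall y, InRn n y -> dist_n n x y < r -> U y.

Definition bounded_set_n (n : nat) (U : pt -> Prop) : Prop :=
  exists M, forall x, U x -> norm_n n x <= M.

Definition convex_set_n (U : pt -> Prop) : Prop :=
  forall x y t, U x -> U y -> 0 <= t <= 1 -> U (fun i => x i + t * (y i - x i)).

Definition closure_n (n : nat) (U : pt -> Prop) : pt -> Prop :=
  fun x => InRn n x /\ forall eps, 0 < eps -> exists y, U y /\ dist_n n x y < eps.

Definition boundary_n (n : nat) (U : pt -> Prop) : pt -> Prop :=
  fun x => closure_n n U x /\ ~ U x.

Definition diam_n (n : nat) (U : pt -> Prop) : R :=
  epsilon (inhabits 0)
    (fun d => is_lub (fun r => exists x y, U x /\ U y /\ r = dist_n n x y) d).

Definition has_partial (f : pt -> R) (i : nat) (x : pt) (l : R) : Prop :=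
  derivable_pt_lim (fun t => f (fun j => x j + t * evec i j)) 0 l.

(* the partial derivative (meaningful where it exists) *)
Definition Dp (f : pt -> R) (i : nat) (x : pt) : R :=
  epsilon (inhabits 0) (fun l => has_partial f i x l).

Definition cont_on (n : nat) (U : pt -> Prop) (f : pt -> R) : Prop :=
  forall x, U x -> forall eps, 0 < eps -> exists d, 0 < d /\
    forall y, U y -> dist_n n x y < d -> Rabs (f y - f x) < eps.

Fixpoint Ck (n : nat) (k : nat) (U : pt -> Prop) (f : pt -> R) : Prop :=
  match k with
  | O => cont_on n U f
  | S k' => cont_on n U f /\
      forall i, (i < n)%nat ->
        (forall x, U x -> has_partial f i x (Dp f i x)) /\ Ck n k' U (fun x => Dp f i x)
  end.

Definition Cinf (n : nat) (U : pt -> Prop) (f : pt -> R) : Prop :=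
  forall k, Ck n k U f.

Definition defining_function (n : nat) (Om : pt -> Prop) (rho : pt -> R) : Prop :=
  Cinf n (InRn n) rho /\
  (forall x, Om x <-> (InRn n x /\ rho x < 0)) /\
  (forall x, boundary_n n Om x -> norm_n n (fun i => Dp rho i x) <> 0).

Definition nu (n : nat) (rho : pt -> R) (x : pt) : pt :=
  fun i => Dp rho i x / norm_n n (fun j => Dp rho j x).

Definition dnormal (n : nat) (rho : pt -> R) (phi : pt -> R) (x : pt) : R :=
  sumR n (fun i => Dp phi i x * nu n rho x i).

Definition inf_lap (n : nat) (phi : pt -> R) (x : pt) : R :=
  sumR n (fun i => sumR n (fun j =>
     Dp phi i x * Dp (fun y => Dp phi i y) j x * Dp phi j x)).

(* E(s, xi, X) with g = |xi| and q = <X xi, xi>; sign chosen by s = u(x0) *)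
Definition Eop (Lam s g q : R) : R :=
  match Rlt_dec 0 s with
  | left _ => Rmin (g - Lam * Rabs s) (- q)
  | right _ =>
    match Rlt_dec s 0 with
    | left _ => Rmax (Lam * Rabs s - g) (- q)
    | right _ => - q
    end
  end.

Definition Eval (n : nat) (Lam : R) (phi : pt -> R) (x : pt) : R :=
  Eop Lam (phi x) (norm_n n (fun i => Dp phi i x)) (inf_lap n phi x).

Definition usc_on (n : nat) (U : pt -> Prop) (u : pt -> R) : Prop :=
  forall x, U x -> forall eps, 0 < eps -> exists d, 0 < d /\
    forall y, U y -> dist_n n x y < d -> u y < u x + eps.

Definition lsc_on (n : nat) (U : pt -> Prop) (u : pt -> R) : Prop :=
  forall x, U x -> forall eps, 0 < eps -> exists d, 0 < d /\
    forall y, U y -> dist_n n x y < d -> u x - eps < u y.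

Definition C2_closure (n : nat) (Om : pt -> Prop) (phi : pt -> R) : Prop :=
  exists V, open_set_n n V /\ (forall x, closure_n n Om x -> V x) /\ Ck n 2 V phi.

Definition visc_sub (n : nat) (Om : pt -> Prop) (rho : pt -> R) (Lam : R)
    (u : pt -> R) : Prop :=
  usc_on n (closure_n n Om) u /\
  (forall x0 phi, Om x0 -> Ck n 2 Om phi -> phi x0 = u x0 ->
     (forall x, Om x -> x <> x0 -> u x < phi x) ->
     Eval n Lam phi x0 <= 0) /\
  (forall x0 phi, boundary_n n Om x0 -> C2_closure n Om phi -> phi x0 = u x0 ->
     (forall x, closure_n n Om x -> x <> x0 -> u x < phi x) ->
     Rmin (Eval n Lam phi x0) (dnormal n rho phi x0) <= 0).

Definition visc_super (n : nat) (Om : pt -> Prop) (rho : pt -> R) (Lam : R)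
    (u : pt -> R) : Prop :=
  lsc_on n (closure_n n Om) u /\
  (forall x0 phi, Om x0 -> Ck n 2 Om phi -> phi x0 = u x0 ->
     (forall x, Om x -> x <> x0 -> u x > phi x) ->
     Eval n Lam phi x0 >= 0) /\
  (forall x0 phi, boundary_n n Om x0 -> C2_closure n Om phi -> phi x0 = u x0 ->
     (forall x, closure_n n Om x -> x <> x0 -> u x > phi x) ->
     Rmax (Eval n Lam phi x0) (dnormal n rho phi x0) >= 0).

Definition visc_sol (n : nat) (Om : pt -> Prop) (rho : pt -> R) (Lam : R)
    (u : pt -> R) : Prop :=
  cont_on n (closure_n n Om) u /\ visc_sub n Om rho Lam u /\ visc_super n Om rho Lam u.

Definition nonconstant_on (U : pt -> Prop) (u : pt -> R) : Prop :=
  exists x y, U x /\ U y /\ u x <> u y.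

Definition lipschitz_on (n : nat) (U : pt -> Prop) (u : pt -> R) : Prop :=
  exists L, forall x y, U x -> U y -> Rabs (u x - u y) <= L * dist_n n x y.

(* Main.v *)
Require Import Defs.
From Stdlib Require Import Reals Lra Lia ClassicalEpsilon FunctionalExtensionality Classical.
Open Scope R_scope.

(* Lower bound.  For [y] in [Om], a subsolution [u] is compared with the strictly concave
   cones [a * |x - y| - gam * |x - y|^2]: convexity makes their normal derivative positive on
   the boundary, so [u] minus the cone has its maximum at [y] or where [u] is below a
   threshold [K].  With [K = u y] and slope tending to [0] this shows that a nonpositive
   subsolution is constant, so a nonconstant solution changes sign.  With [K = 0] and slopes
   above [Lam * max u] it shows that every zero of [u] is at distance at least [1 / Lam] from
   the maximum point and, applied to [- u], from the minimum point; a zero on the segment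
   joining the two gives [2 / Lam <= diam].

   Existence.  Let [p], [q] realize the diameter and [Lam = 2 / diam].  The solution is the
   pointwise infimum of the [Lam]-Lipschitz supersolutions with value [1] at [p] and [-1] at
   [q]; the cone [-1 + Lam * |x - q|] is one of them.  A test function touching this infimum
   from above at a point where the subsolution condition fails has slope strictly less than
   [Lam] there, so Perron's bump stays [Lam]-Lipschitz and contradicts minimality, except at
   [p] and [q], where the condition follows from the Lipschitz bound. *)

(** * Euclidean geometry *)

(** The cone |x - y| is not a C^2 test function at its vertex, nor a polynomial elsewhere. The test
    functions constructed below are therefore built from polynomials of degree at most three in |x -
    y|^2: a Taylor majorant stands in for the cone, fourth powers make touching strict, and
    constants shift. The analysis is reduced to one real variable. The infinity Laplacian of f at x
    is the second derivative of f along the line through x in the direction of its gradient there,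
    and at a boundary point the sign of the normal derivative tells whether that line enters the
    domain. In the existence part [Lam * diam = 2] confines a [Lam]-Lipschitz function with values 1
    at [p] and -1 at [q] to [-1, 1]. Hence [Lam * |u| <= Lam], and a test function of slope exactly
    [Lam] satisfies the required inequality, because the Lipschitz bound fixes the sign of its
    infinity Laplacian. Only smaller slopes are left to the bump, and these leave room for the
    Lipschitz constant. Continuity of the infimum, which Perron's method usually draws from a
    comparison principle, comes from the uniform Lipschitz bound. *)

Lemma sumR_ext n f g : (forall i, (i < n)%nat -> f i = g i) -> sumR n f = sumR n g.
Proof.
  induction n as [|n IH]; simpl; intros H; [easy|].
  rewrite IH, H by (intros; try apply H; lia). easy.
Qed.

Lemma sumR_plus n f g : sumR n (fun i => f i + g i) = sumR n f + sumR n g.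
Proof. induction n; simpl; lra. Qed.

Lemma sumR_scal n c f : sumR n (fun i => c * f i) = c * sumR n f.
Proof. induction n; simpl; lra. Qed.

Lemma sumR_opp n f : sumR n (fun i => - f i) = - sumR n f.
Proof. induction n; simpl; lra. Qed.

Lemma sumR_0 n : sumR n (fun _ => 0) = 0.
Proof. induction n; simpl; lra. Qed.

Lemma sumR_le n f g : (forall i, (i < n)%nat -> f i <= g i) -> sumR n f <= sumR n g.
Proof.
  induction n as [|n IH]; simpl; intros H; [lra|].
  assert (sumR n f <= sumR n g) by (apply IH; intros; apply H; lia).
  specialize (H n ltac:(lia)). lra.
Qed.

Lemma sumR_nonneg n f : (forall i, (i < n)%nat -> 0 <= f i) -> 0 <= sumR n f.
Proof. intros H. rewrite <- (sumR_0 n). now apply sumR_le. Qed.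

Lemma sumR_single_le n f i :
  (forall j, (j < n)%nat -> 0 <= f j) -> (i < n)%nat -> f i <= sumR n f.
Proof.
  induction n as [|n IH]; simpl; intros H Hi; [lia|].
  destruct (Nat.eq_dec i n) as [->|E].
  - assert (0 <= sumR n f) by (apply sumR_nonneg; intros; apply H; lia). lra.
  - assert (f i <= sumR n f) by (apply IH; [intros; apply H|]; lia).
    specialize (H n ltac:(lia)). lra.
Qed.

Lemma sumR_evec n f i : (i < n)%nat -> sumR n (fun j => f j * evec i j) = f i.
Proof.
  induction n as [|n IH]; simpl; intros Hi; [lia|].
  unfold evec at 2. destruct (Nat.eqb_spec n i) as [->|E].
  - rewrite (sumR_ext _ _ (fun _ => 0)), sumR_0; [lra|].
    intros j Hj. unfold evec. destruct (Nat.eqb_spec j i); [lia|lra].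
  - rewrite IH by lia. lra.
Qed.

Definition dot (n : nat) (x y : pt) : R := sumR n (fun i => x i * y i).

(** The body is that of [has_partial] for [p := evec i] and that of [convex_set_n] for
    [p := vsub y x], so both are instances up to conversion. *)
Definition line (x p : pt) (t : R) : pt := fun j => x j + t * p j.

Definition vsub (x y : pt) : pt := fun i => x i - y i.

Lemma dot_sym n x y : dot n x y = dot n y x.
Proof. apply sumR_ext; intros; ring. Qed.

Lemma dot_line n x p t y : dot n (line x p t) y = dot n x y + t * dot n p y.
Proof.
  unfold dot, line. rewrite <- sumR_scal, <- sumR_plus. apply sumR_ext; intros; ring.
Qed.

Lemma dot_vsub n x y z : dot n (vsub x y) z = dot n x z - dot n y z.
Proof.
  unfold dot, vsub, Rminus. rewrite <- sumR_opp, <- sumR_plus. apply sumR_ext; intros; ring.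
Qed.

Lemma dot_nonneg n x : 0 <= dot n x x.
Proof. apply sumR_nonneg; intros; nra. Qed.

Lemma norm_dot n x : norm_n n x = sqrt (dot n x x).
Proof. unfold norm_n, dot. f_equal. apply sumR_ext; intros; ring. Qed.

Lemma norm_nonneg n x : 0 <= norm_n n x.
Proof. apply sqrt_pos. Qed.

Lemma norm_sqr n x : norm_n n x * norm_n n x = dot n x x.
Proof. rewrite norm_dot. apply sqrt_sqrt, dot_nonneg. Qed.

Lemma norm_ext n x y : (forall i, (i < n)%nat -> x i = y i) -> norm_n n x = norm_n n y.
Proof. intros H. unfold norm_n. f_equal. apply sumR_ext; intros; now rewrite H. Qed.

Lemma dot_norm_0 n x y : norm_n n x = 0 -> dot n x y = 0.
Proof.
  intros H. pose proof (norm_sqr n x) as E. rewrite H, Rmult_0_l in E.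
  unfold dot. rewrite (sumR_ext _ _ (fun _ => 0)), sumR_0; [easy|].
  intros i Hi.
  pose proof (sumR_single_le n (fun i => x i * x i) i ltac:(intros; nra) Hi) as L.
  unfold dot in E. simpl in L.
  assert (x i = 0) as -> by nra. ring.
Qed.

Lemma cauchy_schwarz n x y : dot n x y <= norm_n n x * norm_n n y.
Proof.
  pose proof (norm_nonneg n x) as Hx. pose proof (norm_nonneg n y) as Hy.
  destruct (Req_dec (norm_n n x) 0) as [E|E]; [rewrite (dot_norm_0 n x y E), E; lra|].
  destruct (Req_dec (norm_n n y) 0) as [F|F].
  { rewrite dot_sym, (dot_norm_0 n y x F), F; lra. }
  set (a := norm_n n x) in *; set (b := norm_n n y) in *.
  (* The squared length of |y| x - |x| y is expanded and divided by |x| |y|. *)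
  assert (K : 0 <= sumR n (fun i => (b * x i - a * y i) * (b * x i - a * y i)))
    by (apply sumR_nonneg; intros; apply Rle_0_sqr).
  assert (Q : sumR n (fun i => (b * x i - a * y i) * (b * x i - a * y i)) =
     b * b * dot n x x + (- (2 * a * b)) * dot n x y + a * a * dot n y y).
  { unfold dot. rewrite <- !sumR_scal, <- !sumR_plus. apply sumR_ext; intros; ring. }
  rewrite Q, <- !norm_sqr in K. fold a b in K.
  assert (0 < a * b) by nra. nra.
Qed.

Lemma norm_line_le n x p t : norm_n n (line x p t) <= norm_n n x + Rabs t * norm_n n p.
Proof.
  pose proof (norm_nonneg n x). pose proof (norm_nonneg n p). pose proof (Rabs_pos t).
  apply Rsqr_incr_0_var; [|nra]. unfold Rsqr.
  rewrite norm_sqr, dot_line, dot_sym, dot_line, (dot_sym n p (line x p t)), dot_line.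
  rewrite (dot_sym n p x), <- !norm_sqr.
  pose proof (cauchy_schwarz n x p) as C1.
  assert (C2 : - dot n x p <= norm_n n x * norm_n n p).
  { pose proof (cauchy_schwarz n (fun i => - x i) p) as C.
    replace (norm_n n (fun i => - x i)) with (norm_n n x) in C
      by (unfold norm_n; f_equal; apply sumR_ext; intros; ring).
    replace (dot n (fun i => - x i) p) with (- dot n x p) in C
      by (unfold dot; rewrite <- sumR_opp; apply sumR_ext; intros; ring). easy. }
  assert (T : t * t = Rabs t * Rabs t) by (unfold Rabs; destruct Rcase_abs; ring).
  assert (t * dot n x p <= Rabs t * (norm_n n x * norm_n n p)).
  { unfold Rabs; destruct (Rcase_abs t); nra. }
  nra.
Qed.

Lemma norm_scal n p t : norm_n n (fun i => t * p i) = Rabs t * norm_n n p.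
Proof.
  unfold norm_n.
  rewrite (sumR_ext _ _ (fun i => Rsqr t * p i ^ 2)) by (intros; unfold Rsqr; ring).
  rewrite sumR_scal, sqrt_mult, sqrt_Rsqr_abs; [easy|apply Rle_0_sqr|].
  apply sumR_nonneg; intros; nra.
Qed.

Lemma dist_nonneg n x y : 0 <= dist_n n x y.
Proof. apply norm_nonneg. Qed.

Lemma dist_sym n x y : dist_n n x y = dist_n n y x.
Proof.
  unfold dist_n, norm_n. f_equal. apply sumR_ext; intros; ring.
Qed.

Lemma dist_self n x : dist_n n x x = 0.
Proof.
  unfold dist_n, norm_n. rewrite (sumR_ext _ _ (fun _ => 0)), sumR_0; [apply sqrt_0|].
  intros; ring.
Qed.

Lemma norm_triangle n x y : norm_n n (fun i => x i + y i) <= norm_n n x + norm_n n y.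
Proof.
  pose proof (norm_line_le n x y 1) as H. rewrite Rabs_R1, Rmult_1_l in H.
  erewrite norm_ext; [exact H|]. intros; unfold line; ring.
Qed.

Lemma dist_triangle n x y z : dist_n n x z <= dist_n n x y + dist_n n y z.
Proof.
  unfold dist_n. erewrite norm_ext; [apply norm_triangle|]. intros; simpl; ring.
Qed.

Lemma dist_line n x p t : dist_n n x (line x p t) = Rabs t * norm_n n p.
Proof.
  unfold dist_n. rewrite <- (Rabs_Ropp t), <- norm_scal. apply norm_ext.
  intros; unfold line; ring.
Qed.

Lemma dist_line_line n x p s t : dist_n n (line x p s) (line x p t) = Rabs (s - t) * norm_n n p.
Proof.
  unfold dist_n. rewrite <- norm_scal. apply norm_ext. intros; unfold line; ring.
Qed.

Lemma coord_le_norm n x i : (i < n)%nat -> Rabs (x i) <= norm_n n x.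
Proof.
  intros Hi. apply Rsqr_incr_0_var; [|apply norm_nonneg].
  rewrite <- Rsqr_abs. unfold Rsqr. rewrite norm_sqr.
  apply (sumR_single_le n (fun i => x i * x i)); [intros; nra|easy].
Qed.

Lemma norm_le_sum n x : norm_n n x <= sumR n (fun i => Rabs (x i)).
Proof.
  assert (H : dot n x x <= Rsqr (sumR n (fun i => Rabs (x i))) /\
          0 <= sumR n (fun i => Rabs (x i))).
  { unfold dot, Rsqr. induction n as [|n [IH1 IH2]]; simpl; [lra|].
    assert (x n * x n = Rabs (x n) * Rabs (x n)) by (unfold Rabs; destruct Rcase_abs; ring).
    pose proof (Rabs_pos (x n)). split; nra. }
  destruct H as [H1 H2]. rewrite norm_dot, <- (sqrt_Rsqr _ H2). now apply sqrt_le_1_alt.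
Qed.

Lemma dist_0_eq n x y : InRn n x -> InRn n y -> dist_n n x y = 0 -> x = y.
Proof.
  intros Hx Hy H. apply functional_extensionality; intros i.
  destruct (Nat.lt_ge_cases i n) as [L|L].
  - pose proof (coord_le_norm n (fun i => x i - y i) i L) as C. simpl in C.
    unfold dist_n in H. rewrite H in C. revert C. unfold Rabs; destruct Rcase_abs; lra.
  - now rewrite Hx, Hy.
Qed.

Lemma dist_pos n x y : InRn n x -> InRn n y -> x <> y -> 0 < dist_n n x y.
Proof.
  intros Hx Hy N. destruct (dist_nonneg n x y) as [H|H]; [easy|].
  exfalso; apply N, (dist_0_eq n); auto.
Qed.

Lemma dist_sqr n x y : dist_n n x y * dist_n n x y = dot n (vsub x y) (vsub x y).
Proof. unfold dist_n. now rewrite norm_sqr. Qed.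

Lemma InRn_line n x p t : InRn n x -> InRn n p -> InRn n (line x p t).
Proof. intros Hx Hp i Hi. unfold line. rewrite Hx, Hp by easy. ring. Qed.

Lemma InRn_vsub n x y : InRn n x -> InRn n y -> InRn n (vsub x y).
Proof. intros Hx Hp i Hi. unfold vsub. rewrite Hx, Hp by easy. ring. Qed.

Lemma line_0 x p : line x p 0 = x.
Proof. apply functional_extensionality; intros i. unfold line; ring. Qed.

Lemma line_line x p s t : line (line x p s) p t = line x p (s + t).
Proof. apply functional_extensionality; intros i. unfold line; ring. Qed.

Lemma line_1 x y : line x (vsub y x) 1 = y.
Proof. apply functional_extensionality; intros i. unfold line, vsub; ring. Qed.

Lemma dist_line_convex n z x y t : 0 <= t <= 1 ->
  dist_n n z (line x (vsub y x) t) <= (1 - t) * dist_n n z x + t * dist_n n z y.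
Proof.
  intros Ht. unfold dist_n.
  erewrite norm_ext with (y := fun i => (fun i => (1 - t) * (fun i => z i - x i) i) i +
    (fun i => t * (fun i => z i - y i) i) i);
    [|intros; unfold line, vsub; ring].
  eapply Rle_trans; [apply norm_triangle|]. rewrite !norm_scal, !Rabs_pos_eq by lra. lra.
Qed.

Lemma segment_meets_sphere n z x y r : dist_n n z y <= r -> r <= dist_n n z x ->
  exists t, 0 <= t <= 1 /\ dist_n n z (line y (vsub x y) t) = r.
Proof.
  intros Hy Hx.
  (* [IVT] asks for strict signs at both ends; equality is settled by the end points themselves. *)
  destruct (Rle_lt_or_eq_dec _ _ Hy) as [Hy'|E].
  2:{ exists 0. rewrite line_0. split; [lra|easy]. }
  destruct (Rle_lt_or_eq_dec _ _ Hx) as [Hx'|E].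
  2:{ exists 1. rewrite line_1. split; [lra|easy]. }
  destruct (IVT (fun t => dist_n n z (line y (vsub x y) t) - r) 0 1) as (t & Ht & Et).
  - intros t eps He. pose proof (norm_nonneg n (vsub x y)) as N.
    exists (eps / (norm_n n (vsub x y) + 1)). split; [apply Rdiv_lt_0_compat; lra|].
    intros s [_ Hs]. simpl in *. unfold Rdist in *.
    replace (dist_n n z (line y (vsub x y) s) - r - (dist_n n z (line y (vsub x y) t) - r))
      with (dist_n n z (line y (vsub x y) s) - dist_n n z (line y (vsub x y) t)) by ring.
    apply Rle_lt_trans with (Rabs (s - t) * norm_n n (vsub x y)).
    + rewrite <- (dist_line_line n y).
      pose proof (dist_triangle n z (line y (vsub x y) s) (line y (vsub x y) t)).
      pose proof (dist_triangle n z (line y (vsub x y) t) (line y (vsub x y) s)) as T.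
      rewrite (dist_sym n (line y (vsub x y) t) (line y (vsub x y) s)) in T.
      apply Rabs_le. lra.
    + assert (E : eps / (norm_n n (vsub x y) + 1) * (norm_n n (vsub x y) + 1) = eps) by (field; lra).
      pose proof (Rabs_pos (s - t)). nra.
  - lra.
  - rewrite line_0. lra.
  - rewrite line_1. lra.
  - exists t. split; [easy|lra].
Qed.

(** * Compactness and the diameter *)

(** The selection [s] is only required to be cofinal, [k <= s k]: this is what the later limits use,
    and it survives composition. *)
Lemma bounded_seq_cluster (u : nat -> R) M :
  (forall k, Rabs (u k) <= M) ->
  exists (s : nat -> nat) l, (forall k, (k <= s k)%nat) /\ Un_cv (fun k => u (s k)) l.
Proof.
  intros H.
  destruct (Bolzano_Weierstrass u (fun x => - M <= x <= M)) as [l Hl].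
  { apply compact_P3. }
  { intros k. specialize (H k). revert H. unfold Rabs; destruct Rcase_abs; lra. }
  assert (C : forall k, exists p, (k <= p)%nat /\ Rabs (u p - l) < / (INR k + 1)).
  { intros k.
    assert (P : 0 < / (INR k + 1)) by (apply Rinv_0_lt_compat; pose proof (pos_INR k); lra).
    destruct (Hl (disc l (mkposreal _ P)) k) as (p & Hp1 & Hp2).
    - exists (mkposreal _ P). intros x Hx; exact Hx.
    - exists p. split; [easy|exact Hp2]. }
  apply choice in C. destruct C as [s Hs].
  exists s, l. split; [intros k; apply Hs|].
  intros eps He. destruct (archimed_cor1 eps He) as (N & HN & HN0).
  exists N. intros k Hk. unfold Rdist. eapply Rlt_trans; [apply Hs|].
  eapply Rle_lt_trans; [|exact HN].
  apply Rinv_le_contravar; [now apply lt_0_INR|].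
  apply le_INR in Hk. lra.
Qed.

Lemma coordinatewise_cluster (m : nat) (X : nat -> pt) M :
  (forall k i, (i < m)%nat -> Rabs (X k i) <= M) ->
  exists (s : nat -> nat) (l : pt), (forall k, (k <= s k)%nat) /\
    forall i, (i < m)%nat -> Un_cv (fun k => X (s k) i) (l i).
Proof.
  induction m as [|m IH]; intros H.
  { exists (fun k => k), (fun _ => 0). split; intros; lia. }
  destruct IH as (s & l & Hs & Hl); [intros; apply H; lia|].
  destruct (bounded_seq_cluster (fun k => X (s k) m) M) as (s' & a & Hs' & Ha);
    [intros; apply H; lia|].
  exists (fun k => s (s' k)), (fun i => if Nat.eqb i m then a else l i). split.
  { intros k. eapply Nat.le_trans; [apply Hs'|apply Hs]. }
  intros i Hi. destruct (Nat.eqb_spec i m) as [->|E]; [exact Ha|].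
  intros eps He. destruct (Hl i ltac:(lia) eps He) as [N HN].
  exists N. intros k Hk. apply HN. specialize (Hs' k). lia.
Qed.

Lemma dist_of_coords (n : nat) (X : nat -> pt) (l : pt) :
  (forall i, (i < n)%nat -> Un_cv (fun k => X k i) (l i)) ->
  forall eps, 0 < eps -> exists N, forall k, (N <= k)%nat -> dist_n n l (X k) < eps.
Proof.
  intros H.
  assert (G : forall eps, 0 < eps -> exists N, forall k, (N <= k)%nat ->
     sumR n (fun i => Rabs (l i - X k i)) < eps).
  { clear -H. induction n as [|n IH]; intros eps He; simpl; [exists O; intros; lra|].
    destruct (IH ltac:(intros; apply H; lia) (eps / 2) ltac:(lra)) as [N HN].
    destruct (H n ltac:(lia) (eps / 2) ltac:(lra)) as [N' HN'].
    exists (max N N'). intros k Hk. specialize (HN k ltac:(lia)).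
    specialize (HN' k ltac:(lia)). unfold Rdist in HN'. rewrite Rabs_minus_sym in HN'. lra. }
  intros eps He. destruct (G eps He) as [N HN]. exists N. intros k Hk.
  eapply Rle_lt_trans; [apply norm_le_sum|now apply HN].
Qed.

Definition closed_set_n (n : nat) (K : pt -> Prop) : Prop :=
  (forall x, K x -> InRn n x) /\
  forall x, InRn n x -> (forall eps, 0 < eps -> exists y, K y /\ dist_n n x y < eps) -> K x.

Lemma closed_bounded_seq (n : nat) (K : pt -> Prop) (X : nat -> pt) :
  closed_set_n n K -> bounded_set_n n K -> (forall k, K (X k)) ->
  exists (s : nat -> nat) l, K l /\ (forall k, (k <= s k)%nat) /\
    forall eps, 0 < eps -> exists N, forall k, (N <= k)%nat -> dist_n n l (X (s k)) < eps.
Proof.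
  intros [HI HC] [M HM] HX.
  destruct (coordinatewise_cluster n X M) as (s & l & Hs & Hl).
  { intros k i Hi. eapply Rle_trans; [apply (coord_le_norm n _ _ Hi)|apply HM, HX]. }
  (* The limit is cut off at [n], since points of R^n vanish from index [n] on. *)
  set (l' := fun i => if Nat.ltb i n then l i else 0).
  assert (D : forall eps, 0 < eps -> exists N, forall k, (N <= k)%nat ->
     dist_n n l' (X (s k)) < eps).
  { apply (dist_of_coords n (fun k => X (s k))). intros i Hi. unfold l'.
    destruct (Nat.ltb_spec i n); [now apply Hl|lia]. }
  exists s, l'. split; [|now split].
  apply HC.
  - intros i Hi. unfold l'. destruct (Nat.ltb_spec i n); [lia|easy].
  - intros eps He. destruct (D eps He) as [N HN]. exists (X (s N)). split; [easy|].
    apply HN; lia.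
Qed.

(** Sequential compactness is used twice, first to bound [f] above and then on a maximizing
    sequence. *)
Lemma max_attained (n : nat) (K : pt -> Prop) (f : pt -> R) :
  closed_set_n n K -> bounded_set_n n K -> (exists x, K x) -> cont_on n K f ->
  exists z, K z /\ forall x, K x -> f x <= f z.
Proof.
  intros HC HB [x0 Hx0] Hf.
  assert (B : bound (fun r => exists x, K x /\ r = f x)).
  { apply NNPP. intros NB.
    assert (C : forall k : nat, exists x, K x /\ INR k < f x).
    { intros k. apply NNPP. intros NE. apply NB. exists (INR k). intros r (x & Hx & ->).
      apply Rnot_lt_le. intros L. apply NE. eauto. }
    apply choice in C. destruct C as [X HX].
    destruct (closed_bounded_seq n K X) as (s & l & Kl & Hs & Hl); auto;
      [intros k; apply HX|].
    destruct (Hf l Kl 1 ltac:(lra)) as (d & Hd & Hdd).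
    destruct (Hl d Hd) as [N HN].
    destruct (INR_unbounded (f l + 1)) as [N' HN'].
    set (k := max N N').
    specialize (Hdd (X (s k)) ltac:(apply HX) (HN k ltac:(lia))).
    destruct (HX (s k)) as [_ H2].
    assert (INR N' <= INR (s k)) by (apply le_INR; specialize (Hs k); lia).
    revert Hdd. unfold Rabs; destruct Rcase_abs; lra. }
  destruct (completeness _ B) as [m [Hub Hlub]]; [exists (f x0); eauto|].
  assert (C : forall k : nat, exists x, K x /\ m - / (INR k + 1) < f x).
  { intros k. apply NNPP. intros NE.
    assert (0 < / (INR k + 1)) by (apply Rinv_0_lt_compat; pose proof (pos_INR k); lra).
    assert (m <= m - / (INR k + 1)); [|lra].
    apply Hlub. intros r (x & Hx & ->). apply Rnot_lt_le. intros L. apply NE. eauto. }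
  apply choice in C. destruct C as [X HX].
  destruct (closed_bounded_seq n K X) as (s & l & Kl & Hs & Hl); auto;
    [intros k; apply HX|].
  exists l. split; [easy|]. intros x Hx.
  apply Rle_trans with m; [apply Hub; eauto|].
  apply Rnot_lt_le. intros L.
  destruct (Hf l Kl ((m - f l) / 2) ltac:(lra)) as (d & Hd & Hdd).
  destruct (Hl d Hd) as [N HN].
  destruct (archimed_cor1 ((m - f l) / 2) ltac:(lra)) as (N' & HN' & HN0).
  set (k := max N N').
  specialize (Hdd (X (s k)) ltac:(apply HX) (HN k ltac:(lia))).
  destruct (HX (s k)) as [_ H2].
  assert (/ (INR (s k) + 1) <= / INR N').
  { apply Rinv_le_contravar; [now apply lt_0_INR|].
    assert (INR N' <= INR (s k)) by (apply le_INR; specialize (Hs k); lia). lra. }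
  revert Hdd. unfold Rabs; destruct Rcase_abs; lra.
Qed.

Lemma cont_on_opp n U f : cont_on n U f -> cont_on n U (fun x => - f x).
Proof.
  intros H x Hx eps He. destruct (H x Hx eps He) as (d & Hd & K).
  exists d; split; [easy|]. intros y Hy L. specialize (K y Hy L).
  replace (- f y - - f x) with (- (f y - f x)) by ring. now rewrite Rabs_Ropp.
Qed.

Lemma min_attained (n : nat) (K : pt -> Prop) (f : pt -> R) :
  closed_set_n n K -> bounded_set_n n K -> (exists x, K x) -> cont_on n K f ->
  exists z, K z /\ forall x, K x -> f z <= f x.
Proof.
  intros HC HB HE Hf.
  destruct (max_attained n K (fun x => - f x)) as (z & Kz & Hz); auto using cont_on_opp.
  exists z. split; [easy|]. intros x Hx. specialize (Hz x Hx). lra.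
Qed.

Lemma subset_closure n (U : pt -> Prop) : (forall x, U x -> InRn n x) -> forall x, U x -> closure_n n U x.
Proof. intros H x Hx. split; [auto|]. intros eps He. exists x. now rewrite dist_self. Qed.

Lemma closure_closed n U : closed_set_n n (closure_n n U).
Proof.
  split; [intros x Hx; apply Hx|]. intros x Hx H. split; [easy|].
  intros eps He. destruct (H (eps / 2) ltac:(lra)) as (y & [_ Hy] & D).
  destruct (Hy (eps / 2) ltac:(lra)) as (z & Hz & D'). exists z. split; [easy|].
  pose proof (dist_triangle n x y z). lra.
Qed.

Lemma closure_bounded n U : bounded_set_n n U -> bounded_set_n n (closure_n n U).
Proof.
  intros [M HM]. exists (M + 1). intros x [_ Hx].
  destruct (Hx 1 ltac:(lra)) as (y & Hy & D). specialize (HM y Hy).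
  pose proof (norm_triangle n (fun i => x i - y i) y) as T.
  unfold dist_n in D. erewrite norm_ext in T; [|intros i _; apply (Rplus_comm (x i - y i))].
  erewrite (norm_ext n x); [eapply Rle_trans; [exact T|]|intros; simpl; ring]. lra.
Qed.

Lemma closure_inter_ball_closed n U z r :
  closed_set_n n (fun x => closure_n n U x /\ dist_n n z x <= r).
Proof.
  split; [intros x [Hx _]; apply Hx|]. intros x Hx H. split.
  - apply closure_closed; [easy|]. intros eps He. destruct (H eps He) as (y & [Hy _] & D). eauto.
  - apply Rnot_lt_le. intros L. destruct (H (dist_n n z x - r) ltac:(lra)) as (y & [_ Hy] & D).
    pose proof (dist_triangle n z y x). rewrite (dist_sym n y x) in *. lra.
Qed.

Lemma bounded_subset n (U W : pt -> Prop) :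
  (forall x, U x -> W x) -> bounded_set_n n W -> bounded_set_n n U.
Proof. intros H [M HM]. exists M. auto. Qed.

Lemma closure_convex n U : convex_set_n U -> convex_set_n (closure_n n U).
Proof.
  intros HU x y t [Hx Cx] [Hy Cy] Ht. split.
  - intros i Hi. rewrite Hx, Hy by easy. ring.
  - intros eps He. destruct (Cx eps He) as (x' & Ux & Dx). destruct (Cy eps He) as (y' & Uy & Dy).
    exists (fun i => x' i + t * (y' i - x' i)). split; [now apply HU|].
    unfold dist_n in *.
    erewrite norm_ext with
      (y := fun i => (fun i => (1 - t) * (fun i => x i - x' i) i) i + (fun i => t * (fun i => y i - y' i) i) i);
      [|intros; simpl; ring].
    eapply Rle_lt_trans; [apply norm_triangle|]. rewrite !norm_scal.
    rewrite !Rabs_pos_eq by lra.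
    destruct (Rle_dec (norm_n n (fun i => x i - x' i)) (norm_n n (fun i => y i - y' i))); nra.
Qed.

Lemma convex_line U x y t : convex_set_n U -> U x -> U y -> 0 <= t <= 1 -> U (line x (vsub y x) t).
Proof. intros H Hx Hy Ht. exact (H x y t Hx Hy Ht). Qed.

(** [diam_n] is a choice operator; nonemptiness and boundedness make a least upper bound exist and
    so give it its meaning. *)
Lemma diam_is_lub n U : (exists x, U x) -> bounded_set_n n U ->
  is_lub (fun r => exists x y, U x /\ U y /\ r = dist_n n x y) (diam_n n U).
Proof.
  intros [x0 H0] [M HM]. unfold diam_n.
  apply (epsilon_spec (inhabits 0)
    (fun d => is_lub (fun r => exists x y, U x /\ U y /\ r = dist_n n x y) d)).
  destruct (completeness (fun r => exists x y, U x /\ U y /\ r = dist_n n x y)) as [m Hm].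
  - exists (M + M). intros r (x & y & Hx & Hy & ->).
    pose proof (norm_triangle n x (fun i => -1 * y i)) as T.
    rewrite norm_scal, Rabs_left in T by lra. apply HM in Hx, Hy.
    unfold dist_n. erewrite norm_ext; [eapply Rle_trans; [exact T|lra]|intros; simpl; ring].
  - exists (dist_n n x0 x0). eauto.
  - eauto.
Qed.

Lemma dist_closure_le_diam n U x y : (exists x, U x) -> bounded_set_n n U ->
  closure_n n U x -> closure_n n U y -> dist_n n x y <= diam_n n U.
Proof.
  intros HE HB [_ Hx] [_ Hy]. destruct (diam_is_lub n U HE HB) as [Hub _].
  apply Rnot_lt_le. intros L. set (e := (dist_n n x y - diam_n n U) / 2) in *.
  destruct (Hx e ltac:(unfold e; lra)) as (x' & Ux & Dx).
  destruct (Hy e ltac:(unfold e; lra)) as (y' & Uy & Dy).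
  assert (dist_n n x' y' <= diam_n n U) by (apply Hub; eauto).
  pose proof (dist_triangle n x x' y). pose proof (dist_triangle n x' y' y).
  rewrite (dist_sym n y' y) in *. unfold e in *. lra.
Qed.

Lemma dist_cont n K y : cont_on n K (fun x => dist_n n x y).
Proof.
  intros x Hx eps He. exists eps. split; [easy|]. intros z Hz D.
  pose proof (dist_triangle n x z y). pose proof (dist_triangle n z x y).
  rewrite (dist_sym n z x) in *. unfold Rabs; destruct Rcase_abs; lra.
Qed.

(** The maximum over pairs is taken one point at a time: [far x] is a farthest point from [x], and
    the distance from [x] to [far x] is 1-Lipschitz in [x]. *)
Lemma diam_attained n U : (exists x, U x) -> (forall x, U x -> InRn n x) -> bounded_set_n n U ->
  exists p q, closure_n n U p /\ closure_n n U q /\ dist_n n p q = diam_n n U.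
Proof.
  intros HE HI HB.
  assert (HE' : exists x, closure_n n U x)
    by (destruct HE as [x Hx]; exists x; now apply subset_closure).
  pose proof (closure_closed n U) as HC. pose proof (closure_bounded n U HB) as HB'.
  assert (F : forall x, exists y, closure_n n U y /\
     forall z, closure_n n U z -> dist_n n z x <= dist_n n y x).
  { intros x. apply (max_attained n _ (fun y => dist_n n y x)); auto. apply dist_cont. }
  apply choice in F. destruct F as [far Hfar].
  destruct (max_attained n (closure_n n U) (fun x => dist_n n (far x) x)) as (p & Hp & Hmax); auto.
  { intros x Hx eps He. exists eps. split; [easy|]. intros y Hy D.
    destruct (Hfar x) as [A B]. destruct (Hfar y) as [A' B'].
    specialize (B _ A'). specialize (B' _ A).
    pose proof (dist_triangle n (far y) y x). pose proof (dist_triangle n (far x) x y).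
    pose proof (dist_triangle n (far y) x y). pose proof (dist_triangle n (far x) y x).
    rewrite (dist_sym n y x) in *. unfold Rabs; destruct Rcase_abs; lra. }
  destruct (Hfar p) as [A B]. exists (far p), p. split; [easy|]. split; [easy|].
  apply Rle_antisym; [now apply dist_closure_le_diam|].
  destruct (diam_is_lub n U HE HB) as [_ Hlub]. apply Hlub.
  intros r (x & y & Hx & Hy & ->).
  destruct (Hfar y) as [_ By].
  eapply Rle_trans; [apply By; now apply subset_closure|]. apply Hmax. now apply subset_closure.
Qed.

Lemma diam_pos n U : (1 <= n)%nat -> (exists x, U x) -> open_set_n n U -> bounded_set_n n U ->
  0 < diam_n n U.
Proof.
  intros Hn [x Hx] [HI HO] HB. destruct (HO x Hx) as (r & Hr & Hball).
  assert (He : InRn n (evec 0)).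
  { intros i Hi. unfold evec. destruct (Nat.eqb_spec i 0); [lia|easy]. }
  assert (N : norm_n n (evec 0) = 1).
  { rewrite norm_dot. unfold dot. rewrite (sumR_evec n (evec 0) 0) by lia.
    unfold evec; simpl. apply sqrt_1. }
  assert (D : dist_n n x (line x (evec 0) (r / 2)) = r / 2).
  { rewrite dist_line, N, Rabs_pos_eq; lra. }
  assert (U (line x (evec 0) (r / 2))).
  { apply Hball; [now apply InRn_line; auto|lra]. }
  destruct (diam_is_lub n U ltac:(eauto) HB) as [Hub _].
  assert (r / 2 <= diam_n n U); [|lra]. apply Hub. rewrite <- D. eauto.
Qed.

(** * Differential calculus *)

Lemma cont_on_subset n (U W : pt -> Prop) f :
  (forall x, U x -> W x) -> cont_on n W f -> cont_on n U f.
Proof.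
  intros H Hf x Hx eps He. destruct (Hf x (H x Hx) eps He) as (d & Hd & K).
  exists d. split; auto.
Qed.

Lemma cont_on_ext n U f g : (forall x, U x -> f x = g x) -> cont_on n U f -> cont_on n U g.
Proof.
  intros H Hf x Hx eps He. destruct (Hf x Hx eps He) as (d & Hd & K).
  exists d. split; [easy|]. intros y Hy D. rewrite <- !H by easy. auto.
Qed.

Lemma cont_on_const n U c : cont_on n U (fun _ => c).
Proof.
  intros x Hx eps He. exists 1. split; [lra|]. intros. now rewrite Rminus_diag, Rabs_R0.
Qed.

Lemma cont_on_plus n U f g : cont_on n U f -> cont_on n U g -> cont_on n U (fun x => f x + g x).
Proof.
  intros Hf Hg x Hx eps He.
  destruct (Hf x Hx (eps / 2) ltac:(lra)) as (d & Hd & K).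
  destruct (Hg x Hx (eps / 2) ltac:(lra)) as (d' & Hd' & K').
  exists (Rmin d d'). split; [now apply Rmin_pos|]. intros y Hy D.
  specialize (K y Hy (Rlt_le_trans _ _ _ D (Rmin_l _ _))).
  specialize (K' y Hy (Rlt_le_trans _ _ _ D (Rmin_r _ _))).
  replace (f y + g y - (f x + g x)) with ((f y - f x) + (g y - g x)) by ring.
  eapply Rle_lt_trans; [apply Rabs_triang|lra].
Qed.

Lemma cont_on_comp n U (h : R -> R) f :
  cont_on n U f -> (forall x, U x -> continuity_pt h (f x)) -> cont_on n U (fun x => h (f x)).
Proof.
  intros Hf Hh x Hx eps He. destruct (Hh x Hx eps He) as (a & Ha & K).
  destruct (Hf x Hx a Ha) as (d & Hd & K'). exists d. split; [easy|].
  intros y Hy D. destruct (Req_dec (f y) (f x)) as [E|E].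
  - now rewrite E, Rminus_diag, Rabs_R0.
  - apply K. split; [split; [exact I|congruence]|]. now apply K'.
Qed.

Lemma cont_on_sqr n U f : cont_on n U f -> cont_on n U (fun x => f x * f x).
Proof.
  intros Hf. apply (cont_on_comp n U (fun t => t * t)); [easy|]. intros x _. reg.
Qed.

Lemma cont_on_scal n U c f : cont_on n U f -> cont_on n U (fun x => c * f x).
Proof.
  intros Hf. apply (cont_on_comp n U (fun t => c * t)); [easy|]. intros x _. reg.
Qed.

(** Polarization reduces the product to squares, which are compositions with a function of one
    variable. *)
Lemma cont_on_mult n U f g : cont_on n U f -> cont_on n U g -> cont_on n U (fun x => f x * g x).
Proof.
  intros Hf Hg.
  apply cont_on_ext with (fun x => / 4 * ((f x + g x) * (f x + g x)) + (- / 4) * ((f x + -1 * g x) * (f x + -1 * g x))).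
  { intros; field. }
  apply cont_on_plus; apply cont_on_scal, cont_on_sqr, cont_on_plus; auto using cont_on_scal.
Qed.

Lemma cont_on_sum n U m (F : nat -> pt -> R) :
  (forall i, (i < m)%nat -> cont_on n U (F i)) -> cont_on n U (fun x => sumR m (fun i => F i x)).
Proof.
  induction m as [|m IH]; simpl; intros H; [apply cont_on_const|].
  apply cont_on_plus; [apply IH; intros; apply H; lia|apply H; lia].
Qed.

Lemma cont_on_norm n U (F : nat -> pt -> R) :
  (forall i, (i < n)%nat -> cont_on n U (F i)) ->
  cont_on n U (fun x => norm_n n (fun i => F i x)).
Proof.
  intros H. unfold norm_n. apply (cont_on_comp n U sqrt).
  - apply cont_on_sum. intros i Hi. apply cont_on_ext with (fun x => F i x * F i x);
      [intros; ring|]. apply cont_on_sqr; auto.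
  - intros x _. apply continuity_pt_sqrt, sumR_nonneg. intros; nra.
Qed.

Lemma cont_on_coord n U i : (i < n)%nat -> cont_on n U (fun x => x i).
Proof.
  intros Hi x Hx eps He. exists eps. split; [easy|]. intros y Hy D.
  rewrite dist_sym in D. eapply Rle_lt_trans; [|exact D].
  exact (coord_le_norm n (fun i => y i - x i) i Hi).
Qed.

Lemma has_partial_unique f i x l : has_partial f i x l -> Dp f i x = l.
Proof.
  intros H. eapply uniqueness_limite; [|exact H].
  apply (epsilon_spec (inhabits 0) (fun l => has_partial f i x l)). now exists l.
Qed.

Lemma derivable_pt_lim_shift g t l :
  derivable_pt_lim (fun s => g (t + s)) 0 l -> derivable_pt_lim g t l.
Proof.
  intros H eps He. destruct (H eps He) as [d Hd]. exists d. intros h Hh HD.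
  specialize (Hd h Hh HD). now rewrite Rplus_0_l, Rplus_0_r in Hd.
Qed.

Lemma derivable_pt_lim_local (f g : R -> R) t l r : 0 < r ->
  (forall s, Rabs (s - t) < r -> f s = g s) ->
  derivable_pt_lim f t l -> derivable_pt_lim g t l.
Proof.
  intros Hr H Hf eps He. destruct (Hf eps He) as [d Hd].
  assert (P : 0 < Rmin d r) by (apply Rmin_pos; [apply cond_pos|easy]).
  exists (mkposreal _ P). intros h Hh HD. simpl in HD.
  rewrite <- !H.
  - apply Hd; [easy|]. eapply Rlt_le_trans; [exact HD|apply Rmin_l].
  - rewrite Rminus_diag, Rabs_R0. easy.
  - replace (t + h - t) with h by ring. eapply Rlt_le_trans; [exact HD|apply Rmin_r].
Qed.

Lemma derivable_pt_lim_eq f t l l' : l = l' -> derivable_pt_lim f t l -> derivable_pt_lim f t l'.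
Proof. now intros ->. Qed.

Lemma mean_value_from_0 (f f' : R -> R) h :
  (forall c, Rabs c <= Rabs h -> derivable_pt_lim f c (f' c)) ->
  exists c, Rabs c <= Rabs h /\ f h - f 0 = f' c * h.
Proof.
  intros H. destruct (Rtotal_order h 0) as [L|[->|L]].
  - destruct (MVT_cor2 f f' h 0 L) as (c & E & B).
    + intros c Hc. apply H. rewrite !Rabs_left1; lra.
    + exists c. split; [rewrite !Rabs_left1; lra|lra].
  - exists 0. split; [lra|ring].
  - destruct (MVT_cor2 f f' 0 h L) as (c & E & B).
    + intros c Hc. apply H. rewrite !Rabs_pos_eq; lra.
    + exists c. split; [rewrite !Rabs_pos_eq; lra|lra].
Qed.

(** It has two uses: the points x + [trunc k h] form the coordinate path from x to x + h, and
    [trunc n] turns any sequence into a point of R^n. *)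
Definition trunc (k : nat) (h : pt) : pt := fun i => if Nat.ltb i k then h i else 0.

(** Keeps each leg of the coordinate path in the ball of radius |h|, where the partial derivatives
    are controlled. *)
Lemma norm_trunc_le n k t h : Rabs t <= Rabs (h k) ->
  norm_n n (line (trunc k h) (evec k) t) <= norm_n n h.
Proof.
  intros Ht. unfold norm_n. apply sqrt_le_1_alt, sumR_le. intros i Hi.
  unfold line, trunc, evec.
  destruct (Nat.ltb_spec i k); destruct (Nat.eqb_spec i k); try lia.
  - replace (h i + t * 0) with (h i) by ring. lra.
  - subst. rewrite Rplus_0_l, Rmult_1_r. rewrite <- !Rsqr_pow2. now apply Rsqr_le_abs_1.
  - nra.
Qed.

Lemma partials_near n V f x m eps : Ck n 1 V f -> V x -> (m <= n)%nat -> 0 < eps ->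
  exists d, 0 < d /\ forall i y, (i < m)%nat -> V y -> dist_n n x y < d ->
    Rabs (Dp f i y - Dp f i x) < eps.
Proof.
  intros [_ Hf] Hx Hm He. induction m as [|m IH]; [exists 1; split; [lra|intros; lia]|].
  destruct (IH ltac:(lia)) as (d & Hd & K).
  destruct (Hf m ltac:(lia)) as [_ C]. destruct (C x Hx eps He) as (d' & Hd' & K').
  exists (Rmin d d'). split; [now apply Rmin_pos|]. intros i y Hi Hy D.
  destruct (Nat.eq_dec i m) as [->|E].
  - apply K'; [easy|]. eapply Rlt_le_trans; [exact D|apply Rmin_r].
  - apply K; [lia|easy|]. eapply Rlt_le_trans; [exact D|apply Rmin_l].
Qed.

(** The increment telescopes along the coordinate path. On the leg in direction [k] the mean value
    theorem gives the [k]-th partial at a nearby point, which costs at most [eps * |h k|]; hence the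
    sum of absolute values in the error. *)
Lemma C1_differentiable n V f x eps : open_set_n n V -> Ck n 1 V f -> V x -> 0 < eps ->
  exists d, 0 < d /\ forall h, InRn n h -> norm_n n h < d ->
    Rabs (f (line x h 1) - f x - sumR n (fun i => Dp f i x * h i))
      <= eps * sumR n (fun i => Rabs (h i)).
Proof.
  intros [HI HO] Hf Hx He. destruct (HO x Hx) as (r & Hr & Hball).
  destruct (partials_near n V f x n eps Hf Hx (le_n n) He) as (d & Hd & K).
  exists (Rmin d r). split; [now apply Rmin_pos|]. intros h Hh HN.
  assert (HNd := Rlt_le_trans _ _ _ HN (Rmin_l _ _)).
  assert (HNr := Rlt_le_trans _ _ _ HN (Rmin_r _ _)).
  assert (G : forall k, (k <= n)%nat ->
    Rabs (f (line x (trunc k h) 1) - f x - sumR k (fun i => Dp f i x * h i))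
      <= eps * sumR k (fun i => Rabs (h i))).
  { induction k as [|k IH]; intros Hk.
    - simpl. replace (line x (trunc 0 h) 1) with x.
      + rewrite !Rminus_diag, Rabs_R0. lra.
      + apply functional_extensionality; intros i. unfold line, trunc; simpl; ring.
    - specialize (IH ltac:(lia)). set (b := line x (trunc k h) 1) in *.
      assert (Hb : forall t, Rabs t <= Rabs (h k) ->
         V (line b (evec k) t) /\ dist_n n x (line b (evec k) t) < d).
      { intros t Ht. pose proof (norm_trunc_le n k t h Ht) as N.
        assert (D : dist_n n x (line b (evec k) t) = norm_n n (line (trunc k h) (evec k) t)).
        { rewrite dist_sym. apply norm_ext. intros. unfold b, line. ring. }
        split; [|lra]. apply Hball; [|lra].
        intros i Hi. unfold b, line, trunc, evec. rewrite (HI x Hx), (Hh i) by easy.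
        destruct (Nat.ltb_spec i k); destruct (Nat.eqb_spec i k); try lia; ring. }
      destruct (mean_value_from_0 (fun t => f (line b (evec k) t))
        (fun t => Dp f k (line b (evec k) t)) (h k)) as (c & Hc & E).
      { intros c Hc. destruct (Hb c Hc) as [Vc _]. destruct Hf as [_ Hf].
        destruct (Hf k ltac:(lia)) as [P _]. specialize (P _ Vc).
        apply derivable_pt_lim_shift. unfold has_partial in P.
        replace (fun s => f (line b (evec k) (c + s))) with
          (fun t => f (fun j => line b (evec k) c j + t * evec k j)); [exact P|].
        apply functional_extensionality; intros s. now rewrite <- line_line. }
      rewrite line_0 in E. destruct (Hb c Hc) as [Vc Dc].
      specialize (K k _ ltac:(lia) Vc Dc).
      replace (line x (trunc (S k) h) 1) with (line b (evec k) (h k)).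
      2:{ apply functional_extensionality; intros i. unfold b, line, trunc, evec.
          destruct (Nat.ltb_spec i k), (Nat.ltb_spec i (S k)), (Nat.eqb_spec i k);
            try lia; subst; ring. }
      simpl sumR.
      replace (f (line b (evec k) (h k)) - f x -
         (sumR k (fun i => Dp f i x * h i) + Dp f k x * h k)) with
        ((f b - f x - sumR k (fun i => Dp f i x * h i)) +
         (Dp f k (line b (evec k) c) - Dp f k x) * h k) by lra.
      eapply Rle_trans; [apply Rabs_triang|]. rewrite Rabs_mult.
      pose proof (Rabs_pos (h k)). nra. }
  specialize (G n (le_n n)).
  replace (trunc n h) with h in G; [exact G|].
  apply functional_extensionality; intros i. unfold trunc.
  destruct (Nat.ltb_spec i n); [easy|]. now apply Hh.
Qed.

(** [Dp f i] is unspecified for [i >= n]; truncation gives a point of R^n that can serve as a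
    direction of [line]. *)
Definition grad (n : nat) (f : pt -> R) (x : pt) : pt := trunc n (fun i => Dp f i x).

Lemma trunc_lt n h i : (i < n)%nat -> trunc n h i = h i.
Proof. intros H. unfold trunc. destruct (Nat.ltb_spec i n); [easy|lia]. Qed.

Lemma InRn_trunc n h : InRn n (trunc n h).
Proof. intros i Hi. unfold trunc. destruct (Nat.ltb_spec i n); [lia|easy]. Qed.

Lemma dot_grad n f x p : dot n (grad n f x) p = sumR n (fun i => Dp f i x * p i).
Proof. apply sumR_ext. intros. unfold grad. now rewrite trunc_lt. Qed.

Lemma norm_grad n f x : norm_n n (grad n f x) = norm_n n (fun i => Dp f i x).
Proof. apply norm_ext. intros. unfold grad. now rewrite trunc_lt. Qed.

Lemma directional_derivative n V f x p : open_set_n n V -> Ck n 1 V f -> V x -> InRn n p ->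
  derivable_pt_lim (fun t => f (line x p t)) 0 (dot n (grad n f x) p).
Proof.
  intros HV Hf Hx Hp eps He. rewrite dot_grad.
  set (A := sumR n (fun i => Rabs (p i))).
  assert (HA : 0 <= A) by (apply sumR_nonneg; intros; apply Rabs_pos).
  assert (HN := norm_nonneg n p).
  destruct (C1_differentiable n V f x (eps / (A + 1)) HV Hf Hx) as (d & Hd & K).
  { apply Rdiv_lt_0_compat; lra. }
  assert (P : 0 < d / (norm_n n p + 1)) by (apply Rdiv_lt_0_compat; lra).
  exists (mkposreal _ P). simpl. intros t Ht HD.
  assert (Hat := Rabs_pos_lt t Ht).
  specialize (K (fun i => t * p i)). rewrite norm_scal in K.
  assert (E1 : line x (fun i => t * p i) 1 = line x p t)
    by (apply functional_extensionality; intros i; unfold line; ring).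
  rewrite E1 in K.
  rewrite (sumR_ext n (fun i => Dp f i x * (t * p i)) (fun i => t * (Dp f i x * p i))) in K
    by (intros; ring).
  rewrite (sumR_ext n (fun i => Rabs (t * p i)) (fun i => Rabs t * Rabs (p i))) in K
    by (intros; apply Rabs_mult).
  rewrite !sumR_scal in K. fold A in K.
  assert (KK : Rabs (f (line x p t) - f x - t * sumR n (fun i => Dp f i x * p i)) <=
    eps / (A + 1) * (Rabs t * A)).
  { apply K.
    - intros i Hi. rewrite Hp by easy. ring.
    - apply Rle_lt_trans with (Rabs t * (norm_n n p + 1)); [nra|].
      apply (Rmult_lt_compat_r (norm_n n p + 1)) in HD; [|lra].
      unfold Rdiv in HD. rewrite Rmult_assoc, Rinv_l, Rmult_1_r in HD by lra. easy. }
  rewrite Rplus_0_l, line_0.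
  replace ((f (line x p t) - f x) / t - sumR n (fun i => Dp f i x * p i)) with
    ((f (line x p t) - f x - t * sumR n (fun i => Dp f i x * p i)) / t) by (field; easy).
  unfold Rdiv. rewrite Rabs_mult, Rabs_inv.
  apply (Rmult_lt_reg_r (Rabs t)); [easy|].
  rewrite Rmult_assoc, Rinv_l, Rmult_1_r by lra.
  eapply Rle_lt_trans; [exact KK|].
  replace (eps / (A + 1) * (Rabs t * A)) with ((eps * Rabs t) * (A / (A + 1))) by (field; lra).
  assert (A / (A + 1) < 1).
  { apply (Rmult_lt_reg_r (A + 1)); [lra|]. unfold Rdiv. rewrite Rmult_assoc, Rinv_l; lra. }
  assert (0 < eps * Rabs t) by nra. nra.
Qed.

Lemma directional_derivative_at n V f x p t :
  open_set_n n V -> Ck n 1 V f -> V (line x p t) -> InRn n p ->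
  derivable_pt_lim (fun t => f (line x p t)) t (dot n (grad n f (line x p t)) p).
Proof.
  intros HV Hf Hx Hp. apply derivable_pt_lim_shift.
  replace (fun s => f (line x p (t + s))) with (fun s => f (line (line x p t) p s)).
  - now apply directional_derivative with V.
  - apply functional_extensionality; intros s. now rewrite line_line.
Qed.

Lemma Ck_1_of_2 n V f : Ck n 2 V f -> Ck n 1 V f.
Proof. intros [H K]. split; [easy|]. intros i Hi. destruct (K i Hi) as [A [B _]]. now split. Qed.

Lemma Ck_1_partial n V f i : Ck n 2 V f -> (i < n)%nat -> Ck n 1 V (Dp f i).
Proof. intros [H K] Hi. destruct (K i Hi) as [A B]. exact B. Qed.

Definition hess (n : nat) (f : pt -> R) (x p : pt) : R :=
  sumR n (fun i => sumR n (fun j => p i * Dp (Dp f i) j x * p j)).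

Lemma inf_lap_hess n f x : inf_lap n f x = hess n f x (grad n f x).
Proof.
  apply sumR_ext; intros i Hi. apply sumR_ext; intros j Hj. unfold grad.
  now rewrite !trunc_lt.
Qed.

Lemma derivable_pt_lim_sumR m (F : nat -> R -> R) (l : nat -> R) t :
  (forall i, (i < m)%nat -> derivable_pt_lim (F i) t (l i)) ->
  derivable_pt_lim (fun s => sumR m (fun i => F i s)) t (sumR m l).
Proof.
  induction m as [|m IH]; simpl; intros H; [apply derivable_pt_lim_const|].
  apply (derivable_pt_lim_plus (fun s => sumR m (fun i => F i s)) (F m));
    [apply IH; intros; apply H; lia|apply H; lia].
Qed.

(** Together with [inf_lap_hess] this makes the infinity Laplacian accessible to comparisons along a
    single line. *)
Lemma second_directional_derivative n V f x p :
  open_set_n n V -> Ck n 2 V f -> V x -> InRn n p ->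
  derivable_pt_lim (fun t => dot n (grad n f (line x p t)) p) 0 (hess n f x p).
Proof.
  intros HV Hf Hx Hp.
  apply derivable_pt_lim_local with
    (f := fun t => sumR n (fun i => p i * Dp f i (line x p t))) (r := 1); [lra| |].
  { intros s _. rewrite dot_grad. apply sumR_ext; intros; ring. }
  apply derivable_pt_lim_sumR. intros i Hi.
  apply derivable_pt_lim_eq with (p i * dot n (grad n (Dp f i) x) p).
  { rewrite dot_grad, <- sumR_scal. apply sumR_ext; intros; ring. }
  apply (derivable_pt_lim_scal (fun t => Dp f i (line x p t))).
  apply directional_derivative with V; auto using Ck_1_partial.
Qed.

(** One-sided, because a line starting at a boundary point is known to stay in the domain only for
    small [t > 0]. *)
Lemma right_derivative_le (k : R -> R) l c tau : 0 < tau ->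
  derivable_pt_lim k 0 l -> (forall t, 0 < t < tau -> k t <= k 0 + c * t) -> l <= c.
Proof.
  intros Ht H K. apply Rnot_lt_le. intros L.
  destruct (H (l - c) ltac:(lra)) as [d Hd]. pose proof (cond_pos d) as Hd0.
  set (t := Rmin d tau / 2).
  assert (0 < Rmin d tau) by (apply Rmin_pos; lra).
  pose proof (Rmin_l d tau). pose proof (Rmin_r d tau).
  assert (Ht0 : 0 < t) by (unfold t; lra).
  specialize (Hd t ltac:(lra)). rewrite Rplus_0_l, Rabs_pos_eq in Hd by lra.
  specialize (Hd ltac:(unfold t; lra)). specialize (K t ltac:(unfold t in *; lra)).
  assert ((k t - k 0) / t <= c).
  { apply (Rmult_le_reg_r t); [easy|]. unfold Rdiv. rewrite Rmult_assoc, Rinv_l; lra. }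
  revert Hd. unfold Rabs; destruct Rcase_abs; lra.
Qed.

(** To the right of 0, [k] lies below its tangent. The mean value theorem then finds points near 0
    with [k1 t <= c = k1 0], hence a nonpositive difference quotient of [k1]. *)
Lemma right_second_derivative_le (k k1 : R -> R) k2 c tau : 0 < tau ->
  (forall t, 0 <= t < tau -> derivable_pt_lim k t (k1 t)) ->
  derivable_pt_lim k1 0 k2 -> k1 0 = c ->
  (forall t, 0 < t < tau -> k t <= k 0 + c * t) -> k2 <= 0.
Proof.
  intros Ht Hk Hk1 E K. apply Rnot_lt_le. intros L.
  destruct (Hk1 k2 L) as [d Hd]. pose proof (cond_pos d) as Hd0.
  set (b := Rmin d tau / 2).
  assert (0 < Rmin d tau) by (apply Rmin_pos; lra).
  pose proof (Rmin_l d tau). pose proof (Rmin_r d tau).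
  assert (Hb : 0 < b) by (unfold b; lra).
  destruct (MVT_cor2 k k1 0 b Hb) as (t & Et & Bt).
  { intros t Bt. apply Hk. unfold b in *. lra. }
  specialize (K b ltac:(unfold b in *; lra)).
  specialize (Hd t ltac:(lra)). rewrite Rplus_0_l, Rabs_pos_eq in Hd by lra.
  specialize (Hd ltac:(unfold b in *; lra)).
  assert (k1 t <= c) by nra.
  assert ((k1 t - k1 0) / t <= 0).
  { apply (Rmult_le_reg_r t); [lra|]. unfold Rdiv. rewrite Rmult_assoc, Rinv_l; lra. }
  revert Hd. unfold Rabs; destruct Rcase_abs; lra.
Qed.

Lemma open_line n V x p : open_set_n n V -> V x -> InRn n p ->
  exists tau, 0 < tau /\ forall t, Rabs t < tau -> V (line x p t).
Proof.
  intros [HI HO] Hx Hp. destruct (HO x Hx) as (r & Hr & Hball).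
  pose proof (norm_nonneg n p).
  exists (r / (norm_n n p + 1)). split; [apply Rdiv_lt_0_compat; lra|].
  intros t Ht. apply Hball; [apply InRn_line; auto|]. rewrite dist_line.
  apply Rle_lt_trans with (Rabs t * (norm_n n p + 1)); [pose proof (Rabs_pos t); nra|].
  apply (Rmult_lt_compat_r (norm_n n p + 1)) in Ht; [|lra].
  unfold Rdiv in Ht. rewrite Rmult_assoc, Rinv_l, Rmult_1_r in Ht by lra. easy.
Qed.

Lemma InRn_evec n i : (i < n)%nat -> InRn n (evec i).
Proof. intros H j Hj. unfold evec. destruct (Nat.eqb_spec j i); [lia|easy]. Qed.

(** * Functions with explicit second derivatives *)

Definition C2_data (n : nat) (V : pt -> Prop) (f : pt -> R)
    (g : nat -> pt -> R) (H : nat -> nat -> pt -> R) : Prop :=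
  cont_on n V f /\ forall i, (i < n)%nat ->
    (forall x, V x -> has_partial f i x (g i x)) /\ cont_on n V (g i) /\
    forall j, (j < n)%nat ->
      (forall x, V x -> has_partial (g i) j x (H i j x)) /\ cont_on n V (H i j).

Lemma C2_data_Dp n V f g H i x : C2_data n V f g H -> (i < n)%nat -> V x -> Dp f i x = g i x.
Proof. intros [_ K] Hi Hx. apply has_partial_unique. now apply (K i Hi). Qed.

(** [Dp f i] agrees with [g i] on [V] only; openness keeps a short coordinate segment in [V], which
    is all that differentiating once more requires. *)
Lemma C2_data_has_partial2 n V f g H i j x : open_set_n n V -> C2_data n V f g H ->
  (i < n)%nat -> (j < n)%nat -> V x -> has_partial (Dp f i) j x (H i j x).
Proof.
  intros HV HC Hi Hj Hx.
  destruct (open_line n V x (evec j) HV Hx (InRn_evec n j Hj)) as (tau & Ht & Hl).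
  unfold has_partial. apply derivable_pt_lim_local with
    (f := fun t => g i (line x (evec j) t)) (r := tau); [easy| |].
  - intros s Hs. rewrite Rminus_0_r in Hs. symmetry.
    apply (C2_data_Dp n V f g H i (line x (evec j) s) HC Hi). auto.
  - destruct HC as [_ HC]. destruct (HC i Hi) as (_ & _ & K). now apply (K j Hj).
Qed.

Lemma C2_data_Dp2 n V f g H i j x : open_set_n n V -> C2_data n V f g H ->
  (i < n)%nat -> (j < n)%nat -> V x -> Dp (Dp f i) j x = H i j x.
Proof.
  intros. apply has_partial_unique. now apply (C2_data_has_partial2 n V f g H).
Qed.

Lemma C2_data_Ck n V f g H : open_set_n n V -> C2_data n V f g H -> Ck n 2 V f.
Proof.
  intros HV HC. assert (HC' := HC). destruct HC' as [C0 C1].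
  split; [easy|]. intros i Hi. destruct (C1 i Hi) as (A & B & D). split; [|split].
  - intros x Hx. rewrite (C2_data_Dp n V f g H) by easy. auto.
  - apply cont_on_ext with (g i); [|easy]. intros x Hx. symmetry.
    now apply (C2_data_Dp n V f g H).
  - intros j Hj. destruct (D j Hj) as [E F]. split.
    + intros x Hx. change (fun y => Dp f i y) with (Dp f i).
      rewrite (C2_data_Dp2 n V f g H) by easy.
      now apply (C2_data_has_partial2 n V f g H).
    + apply cont_on_ext with (H i j); [|easy]. intros x Hx. symmetry.
      now apply (C2_data_Dp2 n V f g H).
Qed.

Lemma Ck_C2_data n V f : Ck n 2 V f -> C2_data n V f (Dp f) (fun i => Dp (Dp f i)).
Proof.
  intros [C0 C1]. split; [easy|]. intros i Hi. destruct (C1 i Hi) as (A & B & D).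
  repeat split; auto; apply (D j); auto.
Qed.

Lemma C2_data_plus n V f g H f' g' H' : C2_data n V f g H -> C2_data n V f' g' H' ->
  C2_data n V (fun x => f x + f' x) (fun i x => g i x + g' i x) (fun i j x => H i j x + H' i j x).
Proof.
  intros [A B] [A' B']. split; [now apply cont_on_plus|]. intros i Hi.
  destruct (B i Hi) as (C & D & E). destruct (B' i Hi) as (C' & D' & E').
  split; [|split; [now apply cont_on_plus|]].
  - intros x Hx. unfold has_partial.
    apply (derivable_pt_lim_plus (fun t => f (fun j => x j + t * evec i j))
             (fun t => f' (fun j => x j + t * evec i j))); [now apply C|now apply C'].
  - intros j Hj. destruct (E j Hj) as [F G]. destruct (E' j Hj) as [F' G'].
    split; [|now apply cont_on_plus].
    intros x Hx. unfold has_partial.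
    apply (derivable_pt_lim_plus (fun t => g i (fun k => x k + t * evec j k))
             (fun t => g' i (fun k => x k + t * evec j k))); [now apply F|now apply F'].
Qed.

Lemma C2_data_opp n V f g H : C2_data n V f g H ->
  C2_data n V (fun x => - f x) (fun i x => - g i x) (fun i j x => - H i j x).
Proof.
  intros [A B]. split; [now apply cont_on_opp|]. intros i Hi.
  destruct (B i Hi) as (C & D & E).
  split; [|split; [now apply cont_on_opp|]].
  - intros x Hx. unfold has_partial.
    apply (derivable_pt_lim_opp (fun t => f (fun j => x j + t * evec i j))). now apply C.
  - intros j Hj. destruct (E j Hj) as [F G]. split; [|now apply cont_on_opp].
    intros x Hx. unfold has_partial.
    apply (derivable_pt_lim_opp (fun t => g i (fun k => x k + t * evec j k))). now apply F.
Qed.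

(** * Polynomials in the squared distance *)

Definition cubic (a b c d s : R) : R := a + b * s + c * s ^ 2 + d * s ^ 3.

(** The derivative is written as a [cubic] again, so that one formula serves for all orders. *)
Lemma cubic_derivative a b c d s :
  derivable_pt_lim (cubic a b c d) s (cubic b (2 * c) (3 * d) 0 s).
Proof.
  apply derivable_pt_lim_eq with (0 + b * 1 + c * (INR 2 * s ^ 1) + d * (INR 3 * s ^ 2)).
  { unfold cubic; simpl; ring. }
  apply (derivable_pt_lim_plus (fun s => a + b * s + c * s ^ 2) (fun s => d * s ^ 3));
    [apply (derivable_pt_lim_plus (fun s => a + b * s) (fun s => c * s ^ 2));
     [apply (derivable_pt_lim_plus (fun s => a) (fun s => b * s));
      [apply derivable_pt_lim_const|]|]|].
  - apply (derivable_pt_lim_scal (fun s => s)). apply derivable_pt_lim_id.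
  - apply (derivable_pt_lim_scal (fun s => s ^ 2)). apply (derivable_pt_lim_pow s 2).
  - apply (derivable_pt_lim_scal (fun s => s ^ 3)). apply (derivable_pt_lim_pow s 3).
Qed.

Definition sqd (n : nat) (y x : pt) : R := dot n (vsub x y) (vsub x y).

Lemma sqd_dist n y x : sqd n y x = dist_n n x y * dist_n n x y.
Proof. unfold sqd. now rewrite dist_sqr. Qed.

Lemma sqd_self n y : sqd n y y = 0.
Proof. rewrite sqd_dist, dist_self. ring. Qed.

Lemma sqd_line n y x p t :
  sqd n y (line x p t) = sqd n y x + 2 * t * dot n (vsub x y) p + t * t * dot n p p.
Proof.
  unfold sqd, dot. rewrite <- !sumR_scal, <- !sumR_plus. apply sumR_ext; intros.
  unfold vsub, line. ring.
Qed.

Lemma sqd_partial n y x i : (i < n)%nat -> has_partial (sqd n y) i x (2 * (x i - y i)).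
Proof.
  intros Hi. unfold has_partial.
  (* Along a coordinate line the squared distance is a quadratic polynomial, an instance of
     [cubic]. *)
  apply derivable_pt_lim_local with (f := cubic (sqd n y x) (2 * (x i - y i)) 1 0) (r := 1);
    [lra| |].
  - intros s _. change (fun j => x j + s * evec i j) with (line x (evec i) s).
    rewrite sqd_line. unfold dot. rewrite !sumR_evec by easy.
    unfold cubic, vsub, evec. rewrite Nat.eqb_refl. ring.
  - apply derivable_pt_lim_eq with
      (cubic (2 * (x i - y i)) (2 * 1) (3 * 0) 0 0); [unfold cubic; ring|].
    apply cubic_derivative.
Qed.

Lemma sqd_cont n y V : cont_on n V (sqd n y).
Proof.
  apply cont_on_ext with (fun x => dist_n n x y * dist_n n x y).
  - intros. now rewrite sqd_dist.
  - apply cont_on_sqr, dist_cont.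
Qed.

(** One family covers the smooth substitute for a cone, the fourth power of the distance (only [c]
    nonzero) and constants (only [a] nonzero). *)
Definition rad (n : nat) (y : pt) (a b c d : R) (x : pt) : R := cubic a b c d (sqd n y x).

Lemma rad_cont n y a b c d V : cont_on n V (rad n y a b c d).
Proof.
  apply (cont_on_comp n V (cubic a b c d)); [apply sqd_cont|].
  intros x _. apply derivable_continuous_pt. exists (cubic b (2 * c) (3 * d) 0 (sqd n y x)).
  apply cubic_derivative.
Qed.

Lemma rad_partial n y a b c d i x : (i < n)%nat ->
  has_partial (rad n y a b c d) i x (2 * (x i - y i) * rad n y b (2 * c) (3 * d) 0 x).
Proof.
  intros Hi. unfold has_partial, rad.
  rewrite Rmult_comm.
  apply (derivable_pt_lim_comp (fun t => sqd n y (fun j => x j + t * evec i j)) (cubic a b c d)).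
  - now apply sqd_partial.
  - replace (fun j => x j + 0 * evec i j) with x; [apply cubic_derivative|].
    apply functional_extensionality; intros j; ring.
Qed.

Definition rad_grad (n : nat) (y : pt) (a b c d : R) (i : nat) (x : pt) : R :=
  2 * (x i - y i) * rad n y b (2 * c) (3 * d) 0 x.

Definition rad_hess (n : nat) (y : pt) (a b c d : R) (i j : nat) (x : pt) : R :=
  2 * evec j i * rad n y b (2 * c) (3 * d) 0 x +
  2 * (x i - y i) * (2 * (x j - y j) * rad n y (2 * c) (2 * (3 * d)) (3 * 0) 0 x).

Lemma rad_C2_data n y a b c d V :
  C2_data n V (rad n y a b c d) (rad_grad n y a b c d) (rad_hess n y a b c d).
Proof.
  split; [apply rad_cont|]. intros i Hi.
  assert (CC : forall k, (k < n)%nat -> cont_on n V (fun x => 2 * (x k - y k))).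
  { intros k Hk. apply cont_on_scal. apply cont_on_plus; [now apply cont_on_coord|].
    apply cont_on_const. }
  split; [|split].
  - intros x _. now apply rad_partial.
  - apply (cont_on_mult n V (fun x => 2 * (x i - y i))); [now apply CC|apply rad_cont].
  - intros j Hj. split.
    + intros x _. unfold has_partial, rad_grad.
      apply derivable_pt_lim_eq with
        (2 * evec j i * rad n y b (2 * c) (3 * d) 0 (line x (evec j) 0) +
         2 * (x i + 0 * evec j i - y i) *
          (2 * (x j - y j) * rad n y (2 * c) (2 * (3 * d)) (3 * 0) 0 x)).
      { rewrite line_0. unfold rad_hess. ring. }
      apply (derivable_pt_lim_mult (fun t => 2 * (x i + t * evec j i - y i))
        (fun t => rad n y b (2 * c) (3 * d) 0 (line x (evec j) t))).
      * apply derivable_pt_lim_local with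
          (f := cubic (2 * (x i - y i)) (2 * evec j i) 0 0) (r := 1); [lra| |].
        { intros s _. unfold cubic. ring. }
        eapply derivable_pt_lim_eq; [|apply cubic_derivative]. unfold cubic. ring.
      * now apply rad_partial.
    + apply (cont_on_plus n V (fun x => 2 * evec j i * rad n y b (2 * c) (3 * d) 0 x)).
      * apply cont_on_scal, rad_cont.
      * apply (cont_on_mult n V (fun x => 2 * (x i - y i))); [now apply CC|].
        apply (cont_on_mult n V (fun x => 2 * (x j - y j))); [now apply CC|apply rad_cont].
Qed.

Lemma cont_norm_grad n V f : Ck n 1 V f -> cont_on n V (fun x => norm_n n (fun i => Dp f i x)).
Proof. intros [_ H]. apply cont_on_norm. intros i Hi. apply (H i Hi). Qed.

Lemma cont_inf_lap n V f : Ck n 2 V f -> cont_on n V (inf_lap n f).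
Proof.
  intros H. destruct (Ck_C2_data n V f H) as [_ K]. unfold inf_lap.
  apply (cont_on_sum n V n (fun i x => sumR n (fun j => Dp f i x * Dp (Dp f i) j x * Dp f j x))).
  intros i Hi.
  apply (cont_on_sum n V n (fun j x => Dp f i x * Dp (Dp f i) j x * Dp f j x)).
  intros j Hj. apply (cont_on_mult n V (fun x => Dp f i x * Dp (Dp f i) j x)).
  - apply (cont_on_mult n V (Dp f i)); [apply (K i Hi)|].
    destruct (K i Hi) as (_ & _ & L). apply (L j Hj).
  - apply (K j Hj).
Qed.

Lemma cont_dot_grad n V f g : Ck n 1 V f -> Ck n 1 V g ->
  cont_on n V (fun x => dot n (grad n f x) (grad n g x)).
Proof.
  intros [_ Hf] [_ Hg].
  apply cont_on_ext with (fun x => sumR n (fun i => Dp f i x * Dp g i x)).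
  { intros x _. rewrite dot_grad. apply sumR_ext. intros i Hi. unfold grad. now rewrite trunc_lt. }
  apply (cont_on_sum n V n (fun i x => Dp f i x * Dp g i x)). intros i Hi.
  apply (cont_on_mult n V (Dp f i)); [apply (Hf i Hi)|apply (Hg i Hi)].
Qed.

Lemma Ck_subset n k (U V : pt -> Prop) f : (forall x, U x -> V x) -> Ck n k V f -> Ck n k U f.
Proof.
  intros HS. revert f. induction k as [|k IH]; intros f; simpl.
  - now apply cont_on_subset.
  - intros [A B]. split; [now apply cont_on_subset with V|]. intros i Hi.
    destruct (B i Hi) as [C D]. split; auto.
Qed.

Lemma rad_Dp n y a b c d i x : (i < n)%nat ->
  Dp (rad n y a b c d) i x = rad_grad n y a b c d i x.
Proof. intros Hi. apply has_partial_unique. now apply rad_partial. Qed.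

Lemma rad_norm_grad n y a b c d x :
  norm_n n (fun i => Dp (rad n y a b c d) i x) =
  Rabs (2 * rad n y b (2 * c) (3 * d) 0 x) * dist_n n x y.
Proof.
  unfold dist_n. rewrite <- norm_scal. apply norm_ext. intros i Hi.
  rewrite rad_Dp by easy. unfold rad_grad. ring.
Qed.

Lemma rad_grad_dot n y a b c d x p :
  dot n p (grad n (rad n y a b c d) x) =
  2 * rad n y b (2 * c) (3 * d) 0 x * dot n p (vsub x y).
Proof.
  unfold dot. rewrite <- sumR_scal. apply sumR_ext. intros i Hi. unfold grad.
  rewrite trunc_lt, rad_Dp by easy. unfold rad_grad, vsub. ring.
Qed.

(** For a radial function h(|w|^2) with w = x - y, the gradient is 2 h' w and the Hessian is 2 h' I
    + 4 h'' w w^T. The three factors [rad] are h', h' and h''. *)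
Lemma rad_inf_lap n V y a b c d x : open_set_n n V -> V x ->
  inf_lap n (rad n y a b c d) x =
  8 * (rad n y b (2 * c) (3 * d) 0 x) ^ 2 * sqd n y x *
    (rad n y b (2 * c) (3 * d) 0 x +
     2 * sqd n y x * rad n y (2 * c) (2 * (3 * d)) (3 * 0) 0 x).
Proof.
  intros HV Hx.
  set (h1 := rad n y b (2 * c) (3 * d) 0 x).
  set (h2 := rad n y (2 * c) (2 * (3 * d)) (3 * 0) 0 x).
  set (w := vsub x y).
  assert (E : inf_lap n (rad n y a b c d) x =
    sumR n (fun i => (8 * h1 ^ 2 * (h1 + 2 * sqd n y x * h2)) * (w i * w i))).
  2:{ rewrite E, sumR_scal. unfold sqd, dot. fold w. ring. }
  apply sumR_ext. intros i Hi.
  rewrite (sumR_ext n _ (fun j => (8 * h1 ^ 3 * w i) * (w j * evec i j) +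
     16 * h1 ^ 2 * h2 * (w i * w i) * (w j * w j))).
  - rewrite sumR_plus, !sumR_scal, sumR_evec by easy. unfold sqd, dot. fold w. ring.
  - intros j Hj. change (fun z => Dp (rad n y a b c d) i z) with (Dp (rad n y a b c d) i).
    rewrite (C2_data_Dp2 n V _ _ _ i j x HV (rad_C2_data n y a b c d V) Hi Hj Hx).
    rewrite !rad_Dp by easy. unfold rad_grad, rad_hess.
    fold h1 h2. replace (evec j i) with (evec i j)
      by (unfold evec; now rewrite Nat.eqb_sym).
    unfold w, vsub. ring.
Qed.

(* The third Taylor polynomial of [sqrt] at [c ^ 2] lies above [sqrt], because the
   difference factors as [(y - 1) ^ 4 * (y ^ 2 + 4 * y + 5)] in [y = sqrt s / c]. *)
Lemma sqrt_le_taylor c r : 0 < c -> 0 <= r ->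
  r <= cubic (5 / 16 * c) (15 / (16 * c)) (- (5 / (16 * c ^ 3))) (/ (16 * c ^ 5)) (r * r).
Proof.
  intros Hc Hr. unfold cubic.
  assert (E : 5 / 16 * c + 15 / (16 * c) * (r * r) + - (5 / (16 * c ^ 3)) * (r * r) ^ 2 +
    / (16 * c ^ 5) * (r * r) ^ 3 - r =
    c / 16 * ((r / c - 1) ^ 2 * (r / c - 1) ^ 2 * ((r / c + 2) ^ 2 + 1))) by (field; lra).
  assert (0 <= c / 16 * ((r / c - 1) ^ 2 * (r / c - 1) ^ 2 * ((r / c + 2) ^ 2 + 1))); [|lra].
  pose proof (pow2_ge_0 (r / c - 1)). pose proof (pow2_ge_0 (r / c + 2)).
  apply Rmult_le_pos; [lra|]. apply Rmult_le_pos; [nra|lra].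
Qed.

(** * The eigenvalue operator *)

(** The symmetry that exchanges the equations on the two nodal domains; it turns each result on
    supersolutions into one on subsolutions. *)
Lemma Eop_opp L s g q : Eop L (- s) g (- q) = - Eop L s g q.
Proof.
  unfold Eop.
  destruct (Rlt_dec 0 (- s)), (Rlt_dec (- s) 0), (Rlt_dec 0 s), (Rlt_dec s 0); try lra;
    rewrite ?Rabs_Ropp; unfold Rmin, Rmax; repeat destruct Rle_dec; lra.
Qed.

Lemma Eop_antitone L s g q q' : q <= q' -> Eop L s g q' <= Eop L s g q.
Proof.
  intros H. unfold Eop. destruct (Rlt_dec 0 s); [|destruct (Rlt_dec s 0); [|lra]];
    unfold Rmin, Rmax; repeat destruct Rle_dec; lra.
Qed.

(** [Eop] can jump at [s = 0]: there only [- q > 0] is known, but for small [s' > 0] also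
    [g' - L * s'] must be positive. This is what [q < 0 -> 0 < g] secures, and test functions
    satisfy it by [inf_lap_nonzero_grad_pos]. *)
Lemma Eop_pos_open L s g q : 0 <= L -> 0 < Eop L s g q -> (q < 0 -> 0 < g) ->
  exists d, 0 < d /\ forall s' g' q', Rabs (s' - s) < d -> Rabs (g' - g) < d ->
    Rabs (q' - q) < d -> 0 < Eop L s' g' q'.
Proof.
  intros HL H Hq.
  (* The radius [d] must absorb a change of [s] both directly and through the term [L * |s|]. *)
  assert (W : forall a, 0 < a -> exists d, 0 < d /\ d <= a /\ L * d < a).
  { intros a Ha. exists (a / (L + 1)).
    assert (E : (L + 1) * (a / (L + 1)) = a) by (field; lra).
    assert (0 < a / (L + 1)) by (apply Rdiv_lt_0_compat; lra).
    repeat split; nra. }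
  unfold Eop in H.
  destruct (Rlt_dec 0 s) as [S|S]; [|destruct (Rlt_dec s 0) as [S'|S']].
  - assert (H1 := Rlt_le_trans _ _ _ H (Rmin_l _ _)).
    assert (H2 := Rlt_le_trans _ _ _ H (Rmin_r _ _)).
    rewrite Rabs_pos_eq in H1 by lra.
    set (a := Rmin (Rmin s (- q)) ((g - L * s) / 2)).
    assert (0 < a) by (unfold a; repeat apply Rmin_pos; lra).
    assert (a <= s) by (unfold a; eapply Rle_trans; [apply Rmin_l|apply Rmin_l]).
    assert (a <= - q) by (unfold a; eapply Rle_trans; [apply Rmin_l|apply Rmin_r]).
    assert (a <= (g - L * s) / 2) by (unfold a; apply Rmin_r).
    destruct (W a) as (d & Hd & Hda & HLd); [easy|].
    exists d. split; [easy|]. intros s' g' q' A B C.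
    apply Rabs_def2 in A, B, C. unfold Eop.
    destruct (Rlt_dec 0 s'); [|lra]. rewrite Rabs_pos_eq by lra.
    apply Rmin_glb_lt; nra.
  - unfold Rmax in H.
    rewrite Rabs_left in H by lra.
    destruct (Rle_dec (L * - s - g) (- q)) as [T|T].
    + exists (Rmin (- s) (- q)). split; [apply Rmin_pos; lra|].
      pose proof (Rmin_l (- s) (- q)). pose proof (Rmin_r (- s) (- q)).
      intros s' g' q' A B C. apply Rabs_def2 in A, B, C. unfold Eop.
      destruct (Rlt_dec 0 s'); [lra|]. destruct (Rlt_dec s' 0); [|lra].
      eapply Rlt_le_trans; [|apply Rmax_r]. lra.
    + set (a := Rmin (- s) ((L * - s - g) / 2)).
      assert (0 < a) by (unfold a; apply Rmin_pos; lra).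
      assert (a <= - s) by (unfold a; apply Rmin_l).
      assert (a <= (L * - s - g) / 2) by (unfold a; apply Rmin_r).
      destruct (W a) as (d & Hd & Hda & HLd); [easy|].
      exists d. split; [easy|]. intros s' g' q' A B C.
      apply Rabs_def2 in A, B, C. unfold Eop.
      destruct (Rlt_dec 0 s'); [lra|]. destruct (Rlt_dec s' 0); [|lra].
      eapply Rlt_le_trans; [|apply Rmax_l]. rewrite Rabs_left by lra. nra.
  - assert (s = 0) as -> by lra. specialize (Hq ltac:(lra)).
    set (a := Rmin (- q) (g / 2)).
    assert (0 < a) by (unfold a; apply Rmin_pos; lra).
    assert (a <= - q) by (unfold a; apply Rmin_l).
    assert (a <= g / 2) by (unfold a; apply Rmin_r).
    destruct (W a) as (d & Hd & Hda & HLd); [easy|].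
    exists d. split; [easy|]. intros s' g' q' A B C.
    apply Rabs_def2 in A, B, C. unfold Eop.
    destruct (Rlt_dec 0 s'); [|destruct (Rlt_dec s' 0)].
    + rewrite Rabs_pos_eq by lra. apply Rmin_glb_lt; nra.
    + eapply Rlt_le_trans; [|apply Rmax_r]. lra.
    + lra.
Qed.

Lemma inf_lap_grad_0 n f x : norm_n n (fun i => Dp f i x) = 0 -> inf_lap n f x = 0.
Proof.
  intros H. unfold inf_lap. rewrite (sumR_ext _ _ (fun _ => 0)); [apply sumR_0|].
  intros i Hi. pose proof (coord_le_norm n (fun i => Dp f i x) i Hi) as C. rewrite H in C.
  assert (Z : Dp f i x = 0) by (revert C; simpl; unfold Rabs; destruct Rcase_abs; lra).
  rewrite (sumR_ext _ _ (fun _ => 0)); [apply sumR_0|]. intros. rewrite Z. ring.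
Qed.

Lemma inf_lap_nonzero_grad_pos n f x : inf_lap n f x <> 0 -> 0 < norm_n n (fun i => Dp f i x).
Proof.
  intros H. destruct (norm_nonneg n (fun i => Dp f i x)) as [L|E]; [easy|].
  exfalso. apply H. now apply inf_lap_grad_0.
Qed.

(** * Second-order jets and change of sign *)

Definition same_jet (n : nat) (f g : pt -> R) (x : pt) : Prop :=
  forall i, (i < n)%nat -> Dp f i x = Dp g i x /\
    forall j, (j < n)%nat -> Dp (Dp f i) j x = Dp (Dp g i) j x.

Lemma same_jet_norm n f g x : same_jet n f g x ->
  norm_n n (fun i => Dp f i x) = norm_n n (fun i => Dp g i x).
Proof. intros H. apply norm_ext. intros i Hi. now apply H. Qed.

Lemma same_jet_inf_lap n f g x : same_jet n f g x -> inf_lap n f x = inf_lap n g x.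
Proof.
  intros H. apply sumR_ext; intros i Hi. apply sumR_ext; intros j Hj.
  destruct (H i Hi) as [E F]. destruct (H j Hj) as [E' _].
  change (fun y => Dp f i y) with (Dp f i). change (fun y => Dp g i y) with (Dp g i).
  now rewrite E, E', F.
Qed.

Lemma same_jet_dnormal n rho f g x : same_jet n f g x -> dnormal n rho f x = dnormal n rho g x.
Proof. intros H. apply sumR_ext; intros i Hi. now rewrite (proj1 (H i Hi)). Qed.

Lemma same_jet_Eval n Lam f g x : same_jet n f g x -> f x = g x ->
  Eval n Lam f x = Eval n Lam g x.
Proof.
  intros H E. unfold Eval. now rewrite E, (same_jet_norm _ _ _ _ H), (same_jet_inf_lap _ _ _ _ H).
Qed.

Lemma Ck2_plus n V f g : open_set_n n V -> Ck n 2 V f -> Ck n 2 V g ->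
  Ck n 2 V (fun x => f x + g x).
Proof.
  intros HV Hf Hg.
  exact (C2_data_Ck _ _ _ _ _ HV
    (C2_data_plus _ _ _ _ _ _ _ _ (Ck_C2_data _ _ _ Hf) (Ck_C2_data _ _ _ Hg))).
Qed.

Lemma Ck2_rad n V y a b c d : open_set_n n V -> Ck n 2 V (rad n y a b c d).
Proof. intros HV. exact (C2_data_Ck _ _ _ _ _ HV (rad_C2_data n y a b c d V)). Qed.

Lemma Ck2_opp n V f : open_set_n n V -> Ck n 2 V f -> Ck n 2 V (fun x => - f x).
Proof.
  intros HV Hf. exact (C2_data_Ck _ _ _ _ _ HV (C2_data_opp _ _ _ _ _ (Ck_C2_data _ _ _ Hf))).
Qed.

Lemma rad_at_center n y a b c d : rad n y a b c d y = a.
Proof. unfold rad. rewrite sqd_self. unfold cubic. ring. Qed.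

(** The fourth power of the distance to [z] has vanishing derivatives of orders one and two at [z],
    so it makes a contact strict at no cost. *)
Lemma same_jet_plus_quartic n V f z a k : open_set_n n V -> V z -> Ck n 2 V f ->
  same_jet n (fun x => f x + rad n z a 0 k 0 x) f z.
Proof.
  intros HV Hz Hf.
  pose proof (C2_data_plus _ _ _ _ _ _ _ _ (Ck_C2_data _ _ _ Hf) (rad_C2_data n z a 0 k 0 V)) as D.
  intros i Hi. split.
  - rewrite (C2_data_Dp _ _ _ _ _ i z D Hi Hz). unfold rad_grad. ring.
  - intros j Hj. rewrite (C2_data_Dp2 _ _ _ _ _ i j z HV D Hi Hj Hz).
    unfold rad_hess. rewrite rad_at_center. ring.
Qed.

(** The constant [a] is written as a [rad], so that [Ck2_rad] and [Ck2_plus] apply to it as well. *)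
Lemma same_jet_plus_const n V f y x a : open_set_n n V -> V x -> Ck n 2 V f ->
  same_jet n (fun x => f x + rad n y a 0 0 0 x) f x.
Proof.
  intros HV Hx Hf.
  pose proof (C2_data_plus _ _ _ _ _ _ _ _ (Ck_C2_data _ _ _ Hf) (rad_C2_data n y a 0 0 0 V)) as D.
  intros i Hi. split.
  - rewrite (C2_data_Dp _ _ _ _ _ i x D Hi Hx). unfold rad_grad, rad, cubic. ring.
  - intros j Hj. rewrite (C2_data_Dp2 _ _ _ _ _ i j x HV D Hi Hj Hx).
    unfold rad_hess, rad, cubic. ring.
Qed.

Lemma jet_opp n V f x : open_set_n n V -> V x -> Ck n 2 V f ->
  forall i, (i < n)%nat -> Dp (fun x => - f x) i x = - Dp f i x /\
    forall j, (j < n)%nat -> Dp (Dp (fun x => - f x) i) j x = - Dp (Dp f i) j x.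
Proof.
  intros HV Hx Hf.
  pose proof (C2_data_opp _ _ _ _ _ (Ck_C2_data _ _ _ Hf)) as D.
  intros i Hi. split.
  - now rewrite (C2_data_Dp _ _ _ _ _ i x D Hi Hx).
  - intros j Hj. now rewrite (C2_data_Dp2 _ _ _ _ _ i j x HV D Hi Hj Hx).
Qed.

Lemma dnormal_opp n V rho f x : open_set_n n V -> V x -> Ck n 2 V f ->
  dnormal n rho (fun x => - f x) x = - dnormal n rho f x.
Proof.
  intros HV Hx Hf. unfold dnormal. rewrite <- sumR_opp. apply sumR_ext. intros i Hi.
  rewrite (proj1 (jet_opp n V f x HV Hx Hf i Hi)). ring.
Qed.

Lemma norm_grad_opp n V f x : open_set_n n V -> V x -> Ck n 2 V f ->
  norm_n n (fun i => Dp (fun x => - f x) i x) = norm_n n (fun i => Dp f i x).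
Proof.
  intros HV Hx Hf. unfold norm_n. f_equal. apply sumR_ext. intros i Hi.
  rewrite (proj1 (jet_opp n V f x HV Hx Hf i Hi)). ring.
Qed.

Lemma inf_lap_opp n V f x : open_set_n n V -> V x -> Ck n 2 V f ->
  inf_lap n (fun x => - f x) x = - inf_lap n f x.
Proof.
  intros HV Hx Hf.
  unfold inf_lap. rewrite <- sumR_opp. apply sumR_ext. intros i Hi.
  rewrite <- sumR_opp. apply sumR_ext. intros j Hj.
  destruct (jet_opp n V f x HV Hx Hf i Hi) as [A B].
  destruct (jet_opp n V f x HV Hx Hf j Hj) as [A' _].
  change (fun y => Dp (fun x => - f x) i y) with (Dp (fun x => - f x) i).
  change (fun y => Dp f i y) with (Dp f i).
  rewrite A, A', B by easy. ring.
Qed.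

Lemma Eval_opp n V Lam f x : open_set_n n V -> V x -> Ck n 2 V f ->
  Eval n Lam (fun x => - f x) x = - Eval n Lam f x.
Proof.
  intros HV Hx Hf. unfold Eval.
  rewrite (norm_grad_opp n V), (inf_lap_opp n V) by easy. apply Eop_opp.
Qed.

Lemma visc_super_opp n Om rho Lam u : open_set_n n Om ->
  visc_sub n Om rho Lam u -> visc_super n Om rho Lam (fun x => - u x).
Proof.
  intros HO (A & B & C). split; [|split].
  - intros x Hx eps He. destruct (A x Hx eps He) as (d & Hd & K). exists d.
    split; [easy|]. intros y Hy D. specialize (K y Hy D). lra.
  - intros x f Hx Hf E T.
    assert (K : Eval n Lam (fun x => - f x) x <= 0).
    { apply B; auto using Ck2_opp; [lra|]. intros y Hy N. specialize (T y Hy N). lra. }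
    rewrite (Eval_opp n Om) in K by easy. lra.
  - intros x f Hx (V & HV & HS & Hf) E T.
    assert (Vx : V x) by apply HS, Hx.
    assert (K : Rmin (Eval n Lam (fun x => - f x) x) (dnormal n rho (fun x => - f x) x) <= 0).
    { apply C; auto; [exists V; auto using Ck2_opp|lra|].
      intros y Hy N. specialize (T y Hy N). lra. }
    rewrite (Eval_opp n V), (dnormal_opp n V) in K by easy.
    revert K. unfold Rmin, Rmax. repeat destruct Rle_dec; lra.
Qed.

Lemma visc_sub_opp n Om rho Lam u : open_set_n n Om ->
  visc_super n Om rho Lam u -> visc_sub n Om rho Lam (fun x => - u x).
Proof.
  intros HO (A & B & C). split; [|split].
  - intros x Hx eps He. destruct (A x Hx eps He) as (d & Hd & K). exists d.
    split; [easy|]. intros y Hy D. specialize (K y Hy D). lra.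
  - intros x f Hx Hf E T.
    assert (K : Eval n Lam (fun x => - f x) x >= 0).
    { apply B; auto using Ck2_opp; [lra|]. intros y Hy N. specialize (T y Hy N). lra. }
    rewrite (Eval_opp n Om) in K by easy. lra.
  - intros x f Hx (V & HV & HS & Hf) E T.
    assert (Vx : V x) by apply HS, Hx.
    assert (K : Rmax (Eval n Lam (fun x => - f x) x) (dnormal n rho (fun x => - f x) x) >= 0).
    { apply C; auto; [exists V; auto using Ck2_opp|lra|].
      intros y Hy N. specialize (T y Hy N). lra. }
    rewrite (Eval_opp n V), (dnormal_opp n V) in K by easy.
    revert K. unfold Rmin, Rmax. repeat destruct Rle_dec; lra.
Qed.

(** * Viscosity solutions on a smooth convex domain *)

Section Domain.

Variables (n : nat) (Om : pt -> Prop) (rho : pt -> R).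
Hypothesis Om_nonempty : exists x, Om x.
Hypothesis Om_bounded : bounded_set_n n Om.
Hypothesis Om_open : open_set_n n Om.
Hypothesis Om_convex : convex_set_n Om.
Hypothesis Om_rho : defining_function n Om rho.

Local Notation cl := (closure_n n Om).
Local Notation bd := (boundary_n n Om).

Lemma Om_cl x : Om x -> cl x.
Proof. apply subset_closure, Om_open. Qed.

Lemma cl_cases x : cl x -> Om x \/ bd x.
Proof. intros H. destruct (classic (Om x)); [now left|right; now split]. Qed.

Lemma InRn_open : open_set_n n (InRn n).
Proof. split; [easy|]. intros x Hx. exists 1. split; [lra|auto]. Qed.

Lemma rho_C1 : Ck n 1 (InRn n) rho.
Proof. apply Om_rho. Qed.

Lemma rho_cl x : cl x -> rho x <= 0.
Proof.
  intros [Hx H]. apply Rnot_lt_le. intros L. destruct rho_C1 as [C _].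
  destruct (C x Hx (rho x) L) as (d & Hd & K). destruct (H d Hd) as (y & Hy & D).
  specialize (K y (proj1 Om_open y Hy) D). apply Om_rho in Hy. destruct Hy as [_ Hy].
  apply Rabs_def2 in K. lra.
Qed.

Lemma rho_bd z : bd z -> rho z = 0.
Proof.
  intros [Hz N]. pose proof (rho_cl z Hz). apply Rle_antisym; [easy|].
  apply Rnot_lt_le. intros L. apply N, Om_rho. split; [apply Hz|easy].
Qed.

Lemma grad_rho_pos z : bd z -> 0 < norm_n n (grad n rho z).
Proof.
  intros Hz. rewrite norm_grad. destruct Om_rho as (_ & _ & H).
  pose proof (norm_nonneg n (fun i => Dp rho i z)). specialize (H z Hz). lra.
Qed.

(** Along the segment from [z] to [x], which convexity keeps in the closure, [rho] starts at 0 and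
    stays nonpositive. *)
Lemma normal_nonpos z x : bd z -> cl x -> dot n (grad n rho z) (vsub x z) <= 0.
Proof.
  intros Hz Hx. assert (Hz' : cl z) by apply Hz.
  apply (right_derivative_le (fun t => rho (line z (vsub x z) t)) _ 0 1); [lra| |].
  - apply directional_derivative with (InRn n); [apply InRn_open|apply rho_C1|apply Hz'|].
    apply InRn_vsub; [apply Hx|apply Hz'].
  - intros t Ht. rewrite line_0, (rho_bd z Hz).
    pose proof (rho_cl (line z (vsub x z) t)) as R.
    assert (cl (line z (vsub x z) t)); [|specialize (R H); lra].
    apply convex_line; auto using closure_convex. lra.
Qed.

(** An interior point can be pushed a little along the gradient of [rho] without leaving [Om];
    [normal_nonpos] at the pushed point leaves strict room at [x]. *)
Lemma normal_neg z x : bd z -> Om x -> dot n (grad n rho z) (vsub x z) < 0.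
Proof.
  intros Hz Hx. set (N := grad n rho z).
  destruct (open_line n Om x N Om_open Hx (InRn_trunc _ _)) as (tau & Ht & Hl).
  pose proof (normal_nonpos z (line x N (tau / 2)) Hz) as K.
  assert (C : cl (line x N (tau / 2))) by (apply Om_cl, Hl; rewrite Rabs_pos_eq; lra).
  specialize (K C). fold N in K.
  rewrite dot_sym, dot_vsub, dot_line in K. rewrite dot_sym, dot_vsub.
  pose proof (grad_rho_pos z Hz) as P. fold N in P.
  rewrite <- norm_sqr in K. assert (0 < norm_n n N * norm_n n N) by nra. nra.
Qed.

(** At a boundary point [rho z = 0], and a negative derivative makes [rho] negative for small
    [t > 0]. *)
Lemma line_enters z p : cl z -> InRn n p -> (bd z -> dot n (grad n rho z) p < 0) ->
  exists tau, 0 < tau /\ forall t, 0 < t < tau -> Om (line z p t).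
Proof.
  intros Hz Hp Hd. destruct (cl_cases z Hz) as [Oz|Bz].
  - destruct (open_line n Om z p Om_open Oz Hp) as (tau & Ht & Hl).
    exists tau. split; [easy|]. intros t B. apply Hl. rewrite Rabs_pos_eq; lra.
  - specialize (Hd Bz). set (l := dot n (grad n rho z) p) in *.
    destruct (directional_derivative n (InRn n) rho z p InRn_open rho_C1 (proj1 Hz) Hp (- l))
      as [d Hdd]; [lra|].
    exists d. split; [apply cond_pos|]. intros t B.
    specialize (Hdd t ltac:(lra)). rewrite Rabs_pos_eq in Hdd by lra.
    specialize (Hdd ltac:(lra)). fold l in Hdd.
    rewrite Rplus_0_l, line_0, (rho_bd z Bz), Rminus_0_r in Hdd. apply Rabs_def2 in Hdd.
    apply Om_rho. split; [apply InRn_line; [apply Hz|easy]|].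
    assert (rho (line z p t) / t < 0) by lra.
    apply Rnot_le_lt. intros L.
    assert (0 <= rho (line z p t) / t)
      by (apply Rmult_le_pos; [easy|apply Rlt_le, Rinv_0_lt_compat; lra]). lra.
Qed.

Lemma inward_normal_line z : bd z ->
  let p := fun i => -1 * grad n rho z i in
  InRn n p /\ (forall q, dot n q p = - dot n (grad n rho z) q) /\
  dot n (grad n rho z) p < 0 /\
  exists tau, 0 < tau /\ forall t, 0 < t < tau -> Om (line z p t).
Proof.
  intros Bz p.
  assert (Ip : InRn n p).
  { intros i Hi. unfold p, grad. rewrite InRn_trunc by easy. ring. }
  assert (Ep : forall q, dot n q p = - dot n (grad n rho z) q).
  { intros q. unfold dot. rewrite <- sumR_opp. apply sumR_ext. intros. unfold p. ring. }
  assert (dot n (grad n rho z) p < 0).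
  { rewrite Ep, <- norm_sqr. pose proof (grad_rho_pos z Bz). nra. }
  repeat split; auto. apply line_enters; [apply Bz|easy|auto].
Qed.

Lemma dnormal_dot f z : bd z ->
  dnormal n rho f z * norm_n n (grad n rho z) = dot n (grad n rho z) (grad n f z).
Proof.
  intros Hz. pose proof (grad_rho_pos z Hz) as P. rewrite norm_grad in *.
  unfold dnormal. rewrite Rmult_comm, <- sumR_scal, dot_grad.
  apply sumR_ext. intros i Hi. unfold nu, grad. rewrite trunc_lt by easy. field. lra.
Qed.

Lemma dnormal_neg_iff f z : bd z -> dnormal n rho f z < 0 <-> dot n (grad n rho z) (grad n f z) < 0.
Proof.
  intros Hz. pose proof (grad_rho_pos z Hz). rewrite <- (dnormal_dot f z Hz). split; nra.
Qed.

Lemma dnormal_pos_iff f z : bd z -> 0 < dnormal n rho f z <-> 0 < dot n (grad n rho z) (grad n f z).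
Proof.
  intros Hz. pose proof (grad_rho_pos z Hz). rewrite <- (dnormal_dot f z Hz). split; nra.
Qed.

(* The two kinds of test functions, [C^2(Om)] at interior points and [C^2] up to the
   closure at boundary points, are treated uniformly through their domain [V]. *)
Definition test_domain (V : pt -> Prop) : Prop :=
  open_set_n n V /\ (forall x, Om x -> V x) /\
  ((forall x, V x -> Om x) \/ (forall x, cl x -> V x)).

Lemma test_domain_Om : test_domain Om.
Proof. split; [apply Om_open|]. auto. Qed.

(** Subtracting the fourth power of the distance to [y] makes the contact strict and keeps the jet;
    at the boundary the negative normal derivative rules out the second entry of the maximum. *)
Lemma super_nonstrict Lam u V y f :
  visc_super n Om rho Lam u -> test_domain V -> V y -> cl y -> Ck n 2 V f -> f y = u y ->
  (forall x, cl x -> V x -> f x <= u x) -> (bd y -> dnormal n rho f y < 0) ->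
  0 <= Eval n Lam f y.
Proof.
  intros (_ & S1 & S2) (HV & HS & HD) Vy Hy Hf E T Hn.
  set (g := fun x => f x + rad n y 0 0 (-1) 0 x).
  assert (Hg : Ck n 2 V g) by (apply Ck2_plus; auto using Ck2_rad).
  assert (J : same_jet n g f y) by (apply (same_jet_plus_quartic n V); auto).
  assert (gy : g y = f y) by (unfold g; rewrite rad_at_center; ring).
  assert (T' : forall x, cl x -> V x -> x <> y -> u x > g x).
  { intros x Hx Vx N. specialize (T x Hx Vx). unfold g, rad, cubic. rewrite sqd_dist.
    pose proof (dist_pos n x y (proj1 Hx) (proj1 Hy) N) as P.
    assert (0 < dist_n n x y * dist_n n x y) by nra. nra. }
  rewrite <- (same_jet_Eval n Lam g f y J gy).
  destruct (cl_cases y Hy) as [Oy|By].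
  - apply Rge_le, S1; [easy|now apply Ck_subset with V|congruence|].
    intros x Hx N. apply T'; auto using Om_cl.
  - specialize (Hn By). rewrite <- (same_jet_dnormal _ _ _ _ _ J) in Hn.
    destruct HD as [HD|HD]; [exfalso; now apply By, HD|].
    assert (K : Rmax (Eval n Lam g y) (dnormal n rho g y) >= 0).
    { apply S2; [easy| |congruence|].
      - exists V; auto.
      - intros x Hx N. apply T'; auto. }
    revert K. unfold Rmax. destruct Rle_dec; lra.
Qed.

(** Converse of [super_nonstrict]: a boundary test function with nonnegative normal derivative
    already satisfies the condition, so only negative ones remain. *)
Lemma super_intro Lam u : lsc_on n cl u ->
  (forall V y f, test_domain V -> V y -> cl y -> Ck n 2 V f -> f y = u y ->
     (forall x, cl x -> V x -> f x <= u x) -> (bd y -> dnormal n rho f y < 0) ->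
     0 <= Eval n Lam f y) ->
  visc_super n Om rho Lam u.
Proof.
  intros HL H. split; [easy|]. split.
  - intros y f Oy Hf E T. apply Rle_ge. apply (H Om); auto using test_domain_Om, Om_cl.
    + intros x _ Ox. destruct (classic (x = y)) as [->|N]; [lra|].
      specialize (T x Ox N). lra.
    + intros [_ N]. easy.
  - intros y f By (V & HV & HS & Hf) E T.
    destruct (Rlt_le_dec (dnormal n rho f y) 0) as [L|L].
    + apply Rle_ge, Rle_trans with (Eval n Lam f y); [|apply Rmax_l].
      apply (H V); auto.
      * split; [easy|]. split; [intros x Ox; apply HS, Om_cl, Ox|now right].
      * apply HS, By.
      * apply By.
      * intros x Cx _. destruct (classic (x = y)) as [->|N]; [lra|].
        specialize (T x Cx N). lra.
    + apply Rle_ge, Rle_trans with (dnormal n rho f y); [easy|apply Rmax_r].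
Qed.

Lemma sub_nonstrict Lam u V y f :
  visc_sub n Om rho Lam u -> test_domain V -> V y -> cl y -> Ck n 2 V f -> f y = u y ->
  (forall x, cl x -> V x -> u x <= f x) -> (bd y -> 0 < dnormal n rho f y) ->
  Eval n Lam f y <= 0.
Proof.
  intros HS HV Vy Hy Hf E T Hn. assert (OV : open_set_n n V) by apply HV.
  pose proof (super_nonstrict Lam (fun x => - u x) V y (fun x => - f x)) as K.
  rewrite (Eval_opp n V), (dnormal_opp n V) in K by easy.
  assert (0 <= - Eval n Lam f y); [|lra]. apply K; auto.
  - now apply visc_super_opp.
  - now apply Ck2_opp.
  - now rewrite E.
  - intros x Cx Vx. specialize (T x Cx Vx). lra.
  - intros By. specialize (Hn By). lra.
Qed.

Lemma sub_intro Lam u : usc_on n cl u ->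
  (forall V y f, test_domain V -> V y -> cl y -> Ck n 2 V f -> f y = u y ->
     (forall x, cl x -> V x -> u x <= f x) -> (bd y -> 0 < dnormal n rho f y) ->
     Eval n Lam f y <= 0) ->
  visc_sub n Om rho Lam u.
Proof.
  intros HL H.
  replace u with (fun x => - - u x) by (apply functional_extensionality; intros; ring).
  apply visc_sub_opp; [apply Om_open|]. apply super_intro.
  - intros x Hx eps He. destruct (HL x Hx eps He) as (d & Hd & K).
    exists d. split; [easy|]. intros y Hy D. specialize (K y Hy D). lra.
  - intros V y f HV Vy Hy Hf E T Hn. assert (OV : open_set_n n V) by apply HV.
    specialize (H V y (fun x => - f x)).
    rewrite (Eval_opp n V), (dnormal_opp n V) in H by easy.
    assert (- Eval n Lam f y <= 0); [|lra]. apply H; auto.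
    + now apply Ck2_opp.
    + lra.
    + intros x Cx Vx. specialize (T x Cx Vx). lra.
    + intros By. specialize (Hn By). lra.
Qed.

(** Move from [z] along the gradient [p] of [f], a direction that enters the domain because the
    normal derivative is negative. The Lipschitz bound gives [|p|^2 <= L * |p|]. If [|p| = L], then
    [f] lies below its tangent on this half-line, so its second derivative there, the infinity
    Laplacian, is nonpositive. *)
Lemma grad_bound_below L v V z f : 0 <= L ->
  (forall x y, cl x -> cl y -> Rabs (v x - v y) <= L * dist_n n x y) ->
  test_domain V -> V z -> cl z -> Ck n 2 V f -> f z = v z ->
  (forall x, cl x -> V x -> f x <= v x) -> (bd z -> dnormal n rho f z < 0) ->
  norm_n n (fun i => Dp f i z) <= L /\
  (norm_n n (fun i => Dp f i z) = L -> inf_lap n f z <= 0).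
Proof.
  intros L0 HL (OV & SV & DV) Vz Hz Hf E T Hn. rewrite <- norm_grad. set (p := grad n f z).
  assert (Hp : InRn n p) by apply InRn_trunc.
  destruct (line_enters z p Hz Hp) as (tau & Ht & Hl).
  { intros Bz. apply dnormal_neg_iff; auto. }
  assert (K : forall t, 0 < t < tau -> f (line z p t) <= f z + L * norm_n n p * t).
  { intros t B. specialize (Hl t B). specialize (T _ (Om_cl _ Hl) (SV _ Hl)).
    specialize (HL _ _ (Om_cl _ Hl) Hz). rewrite dist_sym, dist_line, (Rabs_pos_eq t) in HL by lra.
    pose proof (Rle_abs (v (line z p t) - v z)).
    replace (L * norm_n n p * t) with (L * (t * norm_n n p)) by ring. lra. }
  assert (D : dot n p p <= L * norm_n n p).
  { apply (right_derivative_le (fun t => f (line z p t)) _ _ tau Ht).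
    - apply directional_derivative with V; auto using Ck_1_of_2.
    - rewrite line_0. exact K. }
  rewrite <- norm_sqr in D. pose proof (norm_nonneg n p) as P. split.
  - destruct P as [P|P]; [nra|now rewrite <- P].
  - intros EL. rewrite inf_lap_hess. fold p.
    apply (right_second_derivative_le (fun t => f (line z p t))
      (fun t => dot n (grad n f (line z p t)) p) _ (L * norm_n n p) tau Ht).
    + intros t B. apply directional_derivative_at with V; auto using Ck_1_of_2.
      destruct (Req_dec t 0) as [->|N]; [now rewrite line_0|]. apply SV, Hl. lra.
    + apply second_directional_derivative with V; auto.
    + rewrite line_0. fold p. rewrite <- norm_sqr, EL. ring.
    + rewrite line_0. exact K.
Qed.

(** * Lower bound for the eigenvalue *)

(** The hypothesis on [Eop] says that above the level [K] a strictly concave cone of slope more than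
    [L] violates the subsolution condition; it is the common core of both applications. *)
Lemma cone_comparison Lam u y L K a :
  visc_sub n Om rho Lam u -> cont_on n cl u -> Om y -> 0 <= L < a ->
  (forall x g q, cl x -> K < u x -> L < g -> q < 0 -> 0 < Eop Lam (u x) g q) ->
  forall x, cl x -> u x <= Rmax (u y) K + a * dist_n n x y.
Proof.
  intros Hs Hu Oy HLa HE x Hx.
  set (D := diam_n n Om).
  assert (HD : forall x, cl x -> dist_n n x y <= D).
  { intros z Hz. apply dist_closure_le_diam; auto using Om_cl. }
  assert (D0 : 0 <= D) by (eapply Rle_trans; [apply dist_nonneg|apply (HD x Hx)]).
  (* With this [gam] the slope [a - 2 * gam * r] of [psi] at distance [r <= D] exceeds [L], and
     [psi] is nonnegative. *)
  set (gam := (a - L) / (2 * (D + 1))).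
  assert (Hg : 0 < gam) by (apply Rdiv_lt_0_compat; lra).
  assert (Hg2 : 2 * gam * (D + 1) = a - L) by (unfold gam; field; lra).
  set (psi := fun x => a * dist_n n x y + (- gam) * sqd n y x).
  assert (Hpsi : cont_on n cl psi).
  { apply (cont_on_plus n cl (fun x => a * dist_n n x y)); apply cont_on_scal;
      [apply dist_cont|apply sqd_cont]. }
  destruct (max_attained n cl (fun x => u x + - psi x)) as (z & Hz & Hmax).
  { apply closure_closed. }
  { now apply closure_bounded. }
  { eauto. }
  { apply (cont_on_plus n cl u); auto using cont_on_opp. }
  assert (G : forall x, cl x -> 0 <= psi x <= a * dist_n n x y).
  { intros w Hw. unfold psi. rewrite sqd_dist. pose proof (HD w Hw).
    pose proof (dist_nonneg n w y). split; [|nra].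
    assert (gam * dist_n n w y <= a) by nra. nra. }
  assert (F : u z - psi z <= Rmax (u y) K).
  2:{ specialize (Hmax x Hx). pose proof (G x Hx). lra. }
  destruct (Rle_lt_dec (u z) K) as [UK|UK].
  { pose proof (G z Hz). pose proof (Rmax_r (u y) K). lra. }
  destruct (classic (z = y)) as [->|N].
  { pose proof (G y Hz). pose proof (Rmax_l (u y) K). lra. }
  exfalso.
  assert (Hyn : InRn n y) by now apply Om_open.
  set (c := dist_n n z y).
  assert (Hc : 0 < c) by (apply dist_pos; auto; apply Hz).
  assert (HcD : c <= D) by now apply HD.
  set (k0 := u z - psi z).
  (* In the function [k0 + psi] the distance is replaced by its majorant from [sqrt_le_taylor], with
     contact at distance [c]; the sum is a cubic in the squared distance. *)
  set (A := k0 + a * (5 / 16 * c)). set (B := a * (15 / (16 * c)) - gam).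
  set (C := a * - (5 / (16 * c ^ 3))). set (Q := a * / (16 * c ^ 5)).
  assert (V : test_domain (InRn n)).
  { split; [apply InRn_open|]. split; [apply Om_open|right; intros w Hw; apply Hw]. }
  assert (Sz : sqd n y z = c ^ 2) by (rewrite sqd_dist; fold c; ring).
  (* The Taylor polynomial shares with the square root the first two derivatives at [c ^ 2], so [H1]
     and [H2] are those of the cone itself. *)
  assert (H1 : rad n y B (2 * C) (3 * Q) 0 z = a / (2 * c) - gam).
  { unfold rad. rewrite Sz. unfold cubic, B, C, Q. field. lra. }
  assert (H2 : rad n y (2 * C) (2 * (3 * Q)) (3 * 0) 0 z = - (a / (4 * c ^ 3))).
  { unfold rad. rewrite Sz. unfold cubic, B, C, Q. field. lra. }
  assert (H1p : 0 < a / (2 * c) - gam).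
  { replace (a / (2 * c) - gam) with ((a - 2 * gam * c) / (2 * c)) by (field; lra).
    apply Rdiv_lt_0_compat; nra. }
  assert (Fz : rad n y A B C Q z = u z).
  { unfold rad. rewrite Sz. unfold cubic, A, B, C, Q, k0, psi. rewrite Sz. fold c. field. lra. }
  assert (K0 : Eval n Lam (rad n y A B C Q) z <= 0).
  { apply (sub_nonstrict Lam u (InRn n)); auto.
    - apply Hz.
    - apply Ck2_rad, InRn_open.
    - intros w Hw _. specialize (Hmax w Hw).
      pose proof (sqrt_le_taylor c (dist_n n w y) Hc (dist_nonneg n w y)) as T.
      rewrite <- sqd_dist in T.
      assert (E : rad n y A B C Q w = k0 - gam * sqd n y w + a *
        cubic (5 / 16 * c) (15 / (16 * c)) (- (5 / (16 * c ^ 3))) (/ (16 * c ^ 5)) (sqd n y w)).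
      { unfold rad, cubic, A, B, C, Q. ring. }
      rewrite E. unfold k0. unfold psi in Hmax at 1. nra.
    (* The gradient is a positive multiple of [z - y], and this points strictly outward because [y]
       is interior. *)
    - intros Bz. apply dnormal_pos_iff; [easy|]. rewrite rad_grad_dot, H1.
      pose proof (normal_neg z y Bz Oy) as P. rewrite dot_sym, dot_vsub in P.
      rewrite (dot_sym n _ (vsub z y)), dot_vsub. nra. }
  assert (P : 0 < Eval n Lam (rad n y A B C Q) z); [|lra].
  unfold Eval. rewrite Fz. apply HE; auto.
  - rewrite rad_norm_grad, H1, Rabs_pos_eq by lra. fold c.
    replace (2 * (a / (2 * c) - gam) * c) with (a - 2 * gam * c) by (field; lra). nra.
  - rewrite (rad_inf_lap n (InRn n)); [|apply InRn_open|apply Hz].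
    rewrite H1, H2, Sz.
    (* Cones are infinity harmonic off the vertex, so only the concave term [- gam] survives. *)
    replace (a / (2 * c) - gam + 2 * c ^ 2 * - (a / (4 * c ^ 3))) with (- gam) by (field; lra).
    assert (0 < 8 * (a / (2 * c) - gam) ^ 2 * c ^ 2); [|nra].
    assert (0 < (a / (2 * c) - gam) ^ 2) by nra. assert (0 < c ^ 2) by nra. nra.
Qed.

(** The slope [a] tends to [L] and an interior vertex [y'] tends to [y]. A violation by [e] is
    contradicted with three losses of [e / 4]: the change of [u] at the vertex, the larger slope,
    and the displacement of the vertex. *)
Lemma cone_comparison_closure Lam u y L K :
  visc_sub n Om rho Lam u -> cont_on n cl u -> cl y -> 0 <= L ->
  (forall x g q, cl x -> K < u x -> L < g -> q < 0 -> 0 < Eop Lam (u x) g q) ->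
  forall x, cl x -> u x <= Rmax (u y) K + L * dist_n n x y.
Proof.
  intros Hs Hu Hy HL HE x Hx. apply Rnot_lt_le. intros N.
  set (e := u x - (Rmax (u y) K + L * dist_n n x y)).
  assert (He : 0 < e) by (unfold e; lra).
  assert (Hd : 0 <= dist_n n x y) by apply dist_nonneg.
  set (a := L + e / (4 * (dist_n n x y + 1))).
  assert (Ha : 0 < e / (4 * (dist_n n x y + 1))) by (apply Rdiv_lt_0_compat; lra).
  assert (Ha2 : e / (4 * (dist_n n x y + 1)) * (dist_n n x y + 1) = e / 4) by (field; lra).
  destruct (Hu y Hy (e / 4) ltac:(lra)) as (d & Hdp & Hdd).
  set (r := Rmin d (e / (4 * (a + 1)))).
  assert (Hr : 0 < r) by (apply Rmin_pos; [lra|apply Rdiv_lt_0_compat; unfold a; lra]).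
  destruct (proj2 Hy r Hr) as (y' & Oy & Dy).
  assert (Dyd := Rlt_le_trans _ _ _ Dy (Rmin_l _ _)).
  assert (Dye := Rlt_le_trans _ _ _ Dy (Rmin_r _ _)).
  specialize (Hdd y' (Om_cl _ Oy) Dyd). apply Rabs_def2 in Hdd.
  pose proof (cone_comparison Lam u y' L K a Hs Hu Oy ltac:(unfold a; lra) HE x Hx) as C.
  assert (M : Rmax (u y') K <= Rmax (u y) K + e / 4).
  { apply Rmax_lub.
    - pose proof (Rmax_l (u y) K). lra.
    - pose proof (Rmax_r (u y) K). lra. }
  pose proof (dist_triangle n x y y') as T.
  assert (Ea : (a + 1) * (e / (4 * (a + 1))) = e / 4) by (field; unfold a; lra).
  assert (a * dist_n n y y' <= e / 4).
  { pose proof (dist_nonneg n y y'). assert (0 < a) by (unfold a; lra). nra. }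
  assert (a * dist_n n x y' <= a * dist_n n x y + a * dist_n n y y').
  { assert (0 < a) by (unfold a; lra). nra. }
  assert (a * dist_n n x y <= L * dist_n n x y + e / 4).
  { unfold a. nra. }
  unfold e in *. lra.
Qed.

(** Where [u] is nonpositive, [Eop] is at least [- q]; so [q < 0] suffices and cones of any positive
    slope are allowed. *)
Lemma nonpos_subsolution_constant Lam u :
  visc_sub n Om rho Lam u -> cont_on n cl u -> (forall x, cl x -> u x <= 0) ->
  forall x y, cl x -> cl y -> u x = u y.
Proof.
  intros Hs Hu Hneg.
  assert (H : forall x y, cl x -> cl y -> u x <= u y).
  { intros x y Hx Hy.
    pose proof (cone_comparison_closure Lam u y 0 (u y) Hs Hu Hy ltac:(lra)) as C.
    assert (u x <= Rmax (u y) (u y) + 0 * dist_n n x y).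
    { apply C; [|easy]. intros w g q Hw _ Hg Hq. specialize (Hneg w Hw). unfold Eop.
      destruct (Rlt_dec 0 (u w)); [lra|]. destruct (Rlt_dec (u w) 0); [|lra].
      eapply Rlt_le_trans; [|apply Rmax_r]. lra. }
    rewrite Rmax_left in H by lra. lra. }
  intros x y Hx Hy. apply Rle_antisym; auto.
Qed.

(** On {u > 0} a slope above [Lam * u z] exceeds [Lam * u]. The cone with vertex [x0] then gives
    [u z <= Lam * u z * dist_n n z x0], to be divided by [u z]. *)
Lemma zero_far_from_max Lam u z x0 : 0 <= Lam ->
  visc_sub n Om rho Lam u -> cont_on n cl u -> cl z -> (forall x, cl x -> u x <= u z) ->
  0 < u z -> cl x0 -> u x0 = 0 -> 1 <= Lam * dist_n n z x0.
Proof.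
  intros HL Hs Hu Hz Hmax Hpos Hx0 E0.
  assert (C : u z <= Rmax (u x0) 0 + Lam * u z * dist_n n z x0).
  { apply (cone_comparison_closure Lam u x0 (Lam * u z) 0); auto; [nra|].
    intros x g q Hx Ux Hg Hq. specialize (Hmax x Hx). unfold Eop.
    destruct (Rlt_dec 0 (u x)); [|lra]. rewrite Rabs_pos_eq by lra.
    apply Rmin_glb_lt; [|lra]. nra. }
  rewrite E0, Rmax_left in C by lra. nra.
Qed.

Lemma segment_zero u x y : cont_on n cl u -> cl x -> cl y -> 0 < u x -> u y < 0 ->
  exists t, 0 <= t <= 1 /\ u (line x (vsub y x) t) = 0.
Proof.
  intros Hu Hx Hy Ux Uy.
  (* [IVT] asks for continuity on all of R, while [u] is controlled on the closure only; [cp] clamps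
     the parameter to [0, 1]. *)
  set (cp := fun t => Rmax 0 (Rmin t 1)).
  assert (Hcp : forall t, 0 <= cp t <= 1).
  { intros t. unfold cp, Rmax, Rmin. repeat destruct Rle_dec; lra. }
  assert (Lip : forall s t, Rabs (cp s - cp t) <= Rabs (s - t)).
  { intros s t. unfold cp, Rmax, Rmin. repeat destruct Rle_dec;
      unfold Rabs; repeat destruct Rcase_abs; lra. }
  assert (Hcl : forall t, 0 <= t <= 1 -> cl (line x (vsub y x) t)).
  { intros t Ht. apply convex_line; auto using closure_convex. }
  destruct (IVT (fun t => - u (line x (vsub y x) (cp t))) 0 1) as (t & Ht & Et).
  - intros t eps He.
    destruct (Hu _ (Hcl _ (Hcp t)) eps He) as (d & Hd & K).
    pose proof (norm_nonneg n (vsub y x)) as N.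
    exists (d / (norm_n n (vsub y x) + 1)). split; [apply Rdiv_lt_0_compat; lra|].
    intros s [_ Hs]. simpl in *. unfold Rdist in *.
    rewrite Rminus_def, Ropp_involutive, Rplus_comm, <- Rminus_def, Rabs_minus_sym.
    apply K; [apply Hcl, Hcp|]. rewrite dist_line_line, Rabs_minus_sym.
    apply Rle_lt_trans with (Rabs (s - t) * (norm_n n (vsub y x) + 1)).
    + apply Rmult_le_compat; try lra; auto using Rabs_pos.
    + apply (Rmult_lt_compat_r (norm_n n (vsub y x) + 1)) in Hs; [|lra].
      unfold Rdiv in Hs. rewrite Rmult_assoc, Rinv_l, Rmult_1_r in Hs by lra. easy.
  - lra.
  - replace (cp 0) with 0; [rewrite line_0; lra|].
    unfold cp, Rmax, Rmin. repeat destruct Rle_dec; lra.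
  - replace (cp 1) with 1; [rewrite line_1; lra|].
    unfold cp, Rmax, Rmin. repeat destruct Rle_dec; lra.
  - exists (cp t). split; [apply Hcp|lra].
Qed.

Lemma eigenvalue_lower_bound Lam u : 0 <= Lam -> (1 <= n)%nat ->
  visc_sol n Om rho Lam u -> nonconstant_on cl u -> Lam >= 2 / diam_n n Om.
Proof.
  intros HL Hn (Hu & Hsub & Hsup) (x1 & x2 & Hx1 & Hx2 & Hne).
  assert (Hsub' := visc_sub_opp n Om rho Lam u Om_open Hsup).
  assert (Hu' := cont_on_opp n cl u Hu).
  assert (CC := closure_closed n Om). assert (CB := closure_bounded n Om Om_bounded).
  destruct (max_attained n cl u) as (zM & HzM & HM); eauto.
  destruct (min_attained n cl u) as (zm & Hzm & Hm); eauto.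
  assert (PM : 0 < u zM).
  { apply Rnot_le_lt. intros N. apply Hne.
    apply (nonpos_subsolution_constant Lam u); auto.
    intros x Hx. specialize (HM x Hx). lra. }
  assert (Pm : u zm < 0).
  { apply Rnot_le_lt. intros N. apply Hne.
    assert (- u x1 = - u x2); [|lra].
    apply (nonpos_subsolution_constant Lam (fun x => - u x)); auto.
    intros x Hx. specialize (Hm x Hx). lra. }
  destruct (segment_zero u zM zm Hu HzM Hzm PM Pm) as (t & Ht & Et).
  set (x0 := line zM (vsub zm zM) t) in *.
  assert (Hx0 : cl x0) by (apply convex_line; auto using closure_convex).
  assert (D1 : 1 <= Lam * dist_n n zM x0) by (apply (zero_far_from_max Lam u); auto).
  assert (D2 : 1 <= Lam * dist_n n zm x0).
  { apply (zero_far_from_max Lam (fun x => - u x)); auto; [|lra|lra].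
    intros x Hx. specialize (Hm x Hx). lra. }
  assert (HD := dist_closure_le_diam n Om zM zm Om_nonempty Om_bounded HzM Hzm).
  assert (E1 : dist_n n zM x0 = t * dist_n n zM zm).
  { unfold x0. rewrite dist_line, Rabs_pos_eq by lra. f_equal. rewrite dist_sym. reflexivity. }
  assert (E2 : dist_n n zm x0 = (1 - t) * dist_n n zM zm).
  { rewrite <- (line_1 zM zm) at 1. unfold x0. rewrite dist_line_line, Rabs_pos_eq by lra.
    f_equal. rewrite dist_sym. reflexivity. }
  rewrite E1 in D1. rewrite E2 in D2.
  pose proof (diam_pos n Om Hn Om_nonempty Om_open Om_bounded) as DP.
  (* The distances from the zero to the two extremal points are the fractions [t] and [1 - t] of one
     length, so the two bounds add up. *)
  assert (2 <= Lam * diam_n n Om) by nra.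
  apply Rle_ge. apply (Rmult_le_reg_r (diam_n n Om)); [easy|].
  unfold Rdiv. rewrite Rmult_assoc, Rinv_l; lra.
Qed.

(** * Existence by Perron's method *)

Lemma grad_bound_above L v V z f : 0 <= L ->
  (forall x y, cl x -> cl y -> Rabs (v x - v y) <= L * dist_n n x y) ->
  test_domain V -> V z -> cl z -> Ck n 2 V f -> f z = v z ->
  (forall x, cl x -> V x -> v x <= f x) -> (bd z -> 0 < dnormal n rho f z) ->
  norm_n n (fun i => Dp f i z) <= L /\
  (norm_n n (fun i => Dp f i z) = L -> 0 <= inf_lap n f z).
Proof.
  intros L0 HL HV Vz Hz Hf E T Hn. assert (OV : open_set_n n V) by apply HV.
  pose proof (grad_bound_below L (fun x => - v x) V z (fun x => - f x) L0) as K.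
  rewrite (norm_grad_opp n V), (inf_lap_opp n V), (dnormal_opp n V) in K by easy.
  destruct K as [K1 K2]; auto using Ck2_opp.
  - intros x y Hx Hy. replace (- v x - - v y) with (- (v x - v y)) by ring.
    rewrite Rabs_Ropp. auto.
  - now rewrite E.
  - intros x Hx Vx. specialize (T x Hx Vx). lra.
  - intros Bz. specialize (Hn Bz). lra.
  - split; [easy|]. intros EL. specialize (K2 EL). lra.
Qed.

Lemma lipschitz_cont L v : 0 <= L ->
  (forall x y, cl x -> cl y -> Rabs (v x - v y) <= L * dist_n n x y) -> cont_on n cl v.
Proof.
  intros HL H x Hx eps He. exists (eps / (L + 1)). split; [apply Rdiv_lt_0_compat; lra|].
  intros y Hy D. specialize (H y x Hy Hx). rewrite dist_sym in H.
  eapply Rle_lt_trans; [exact H|].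
  assert (E : (L + 1) * (eps / (L + 1)) = eps) by (field; lra).
  pose proof (dist_nonneg n x y). nra.
Qed.

Lemma cont_lsc v : cont_on n cl v -> lsc_on n cl v.
Proof.
  intros H x Hx eps He. destruct (H x Hx eps He) as (d & Hd & K). exists d.
  split; [easy|]. intros y Hy D. specialize (K y Hy D). apply Rabs_def2 in K. lra.
Qed.

Lemma cont_usc v : cont_on n cl v -> usc_on n cl v.
Proof.
  intros H x Hx eps He. destruct (H x Hx eps He) as (d & Hd & K). exists d.
  split; [easy|]. intros y Hy D. specialize (K y Hy D). apply Rabs_def2 in K. lra.
Qed.

(** Used in every direction at interior points, where it makes the gradients equal, and in the
    inward normal direction at the boundary. *)
Lemma touching_directional V V' f g y p r :
  test_domain V -> test_domain V' -> V y -> V' y -> Ck n 1 V f -> Ck n 1 V' g -> f y = g y ->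
  0 < r -> (forall x, Om x -> dist_n n y x < r -> f x <= g x) ->
  cl y -> InRn n p -> (bd y -> dot n (grad n rho y) p < 0) ->
  dot n (grad n f y) p <= dot n (grad n g y) p.
Proof.
  intros HV HV' Vy Vy' Hf Hg E Hr T Hy Hp Hd.
  destruct (line_enters y p Hy Hp Hd) as (tau & Ht & Hl).
  assert (Hball : exists s, 0 < s /\ forall t, 0 < t < s -> dist_n n y (line y p t) < r).
  { pose proof (norm_nonneg n p). exists (r / (norm_n n p + 1)).
    split; [apply Rdiv_lt_0_compat; lra|]. intros t B. rewrite dist_line, Rabs_pos_eq by lra.
    assert (r / (norm_n n p + 1) * (norm_n n p + 1) = r) by (field; lra). nra. }
  destruct Hball as (s & Hs & Hball).
  assert (dot n (grad n f y) p - dot n (grad n g y) p <= 0); [|lra].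
  apply (right_derivative_le (fun t => f (line y p t) - g (line y p t)) _ 0 (Rmin tau s)).
  - now apply Rmin_pos.
  - apply (derivable_pt_lim_minus (fun t => f (line y p t)) (fun t => g (line y p t)));
      [apply directional_derivative with V|apply directional_derivative with V'];
      auto; [apply HV|apply HV'].
  - intros t [B1 B2]. pose proof (Rmin_l tau s). pose proof (Rmin_r tau s).
    specialize (Hl t ltac:(lra)). specialize (Hball t ltac:(lra)).
    specialize (T _ Hl Hball). rewrite !line_0, E. lra.
Qed.

(** The difference [p] of the gradients is itself an admissible direction, which forces
    [|p|^2 <= 0]. Along the common gradient [f - g] then has nonpositive second derivative, and
    [Eop] is antitone in the infinity Laplacian. *)
Lemma touching_interior Lam V V' f g y r :
  test_domain V -> test_domain V' -> Ck n 2 V f -> Ck n 2 V' g -> f y = g y ->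
  0 < r -> (forall x, Om x -> dist_n n y x < r -> f x <= g x) -> Om y ->
  Eval n Lam g y <= Eval n Lam f y.
Proof.
  intros HV HV' Hf Hg E Hr T Oy.
  assert (Vy : V y) by now apply HV. assert (Vy' : V' y) by now apply HV'.
  assert (G : grad n f y = grad n g y).
  { apply (dist_0_eq n); try apply InRn_trunc.
    set (p := vsub (grad n f y) (grad n g y)).
    assert (K : dot n (grad n f y) p <= dot n (grad n g y) p).
    { apply (touching_directional V V' f g y p r); auto using Ck_1_of_2, Om_cl.
      - apply InRn_vsub; apply InRn_trunc.
      - intros [_ N]. easy. }
    assert (S : dist_n n (grad n f y) (grad n g y) * dist_n n (grad n f y) (grad n g y) <= 0).
    { rewrite dist_sqr. fold p. unfold p at 1. rewrite dot_vsub. lra. }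
    pose proof (dist_nonneg n (grad n f y) (grad n g y)). nra. }
  set (p := grad n f y) in *. assert (Hp : InRn n p) by apply InRn_trunc.
  assert (Hq : inf_lap n f y <= inf_lap n g y).
  { rewrite !inf_lap_hess, <- G. fold p.
    destruct (open_line n Om y p Om_open Oy Hp) as (tau & Ht & Hl).
    pose proof (norm_nonneg n p) as N.
    set (s := r / (norm_n n p + 1)).
    assert (Hs : 0 < s) by (apply Rdiv_lt_0_compat; lra).
    assert (Hs2 : s * (norm_n n p + 1) = r) by (unfold s; field; lra).
    assert (hess n f y p - hess n g y p <= 0); [|lra].
    apply (right_second_derivative_le (fun t => f (line y p t) - g (line y p t))
      (fun t => dot n (grad n f (line y p t)) p - dot n (grad n g (line y p t)) p) _ 0 (Rmin tau s)).
    - now apply Rmin_pos.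
    - intros t B. pose proof (Rmin_l tau s).
      assert (O : Om (line y p t)) by (apply Hl; rewrite Rabs_pos_eq; lra).
      apply (derivable_pt_lim_minus (fun t => f (line y p t)) (fun t => g (line y p t)));
        [apply directional_derivative_at with V|apply directional_derivative_at with V'];
        auto using Ck_1_of_2; try apply HV; try apply HV'; auto.
    - apply (derivable_pt_lim_minus (fun t => dot n (grad n f (line y p t)) p)
        (fun t => dot n (grad n g (line y p t)) p));
        [apply second_directional_derivative with V|apply second_directional_derivative with V'];
        auto; [apply HV|apply HV'].
    - rewrite !line_0, <- G. fold p. ring.
    - intros t [B1 B2]. pose proof (Rmin_l tau s). pose proof (Rmin_r tau s).
      assert (O : Om (line y p t)) by (apply Hl; rewrite Rabs_pos_eq; lra).
      specialize (T _ O). rewrite dist_line, Rabs_pos_eq in T by lra.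
      rewrite !line_0, E. specialize (T ltac:(nra)). lra. }
  unfold Eval. rewrite <- E, <- !norm_grad, <- G. now apply Eop_antitone.
Qed.

(** The extra shift [s] of the value allows a small constant to be added to [f] later. *)
Lemma strict_sub_near Lam V z f : 0 <= Lam -> test_domain V -> V z -> cl z -> Ck n 2 V f ->
  0 < Eval n Lam f z -> (bd z -> 0 < dnormal n rho f z) ->
  exists d, 0 < d /\ (forall y, InRn n y -> dist_n n z y < d -> V y) /\
    forall y, V y -> dist_n n z y < d ->
      (forall s, Rabs s < d ->
        0 < Eop Lam (f y + s) (norm_n n (fun i => Dp f i y)) (inf_lap n f y)) /\
      (bd y -> 0 < dnormal n rho f y).
Proof.
  intros HL HV Vz Hz Hf He Hn. assert (OV : open_set_n n V) by apply HV.
  destruct (Eop_pos_open _ _ _ _ HL He) as (e & He0 & Hop).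
  { intros Q. apply inf_lap_nonzero_grad_pos. lra. }
  destruct (proj2 OV z Vz) as (d0 & Hd0 & B0).
  destruct (proj1 Hf z Vz (e / 2) ltac:(lra)) as (d1 & Hd1 & B1).
  destruct (cont_norm_grad n V f (Ck_1_of_2 _ _ _ Hf) z Vz e He0) as (d2 & Hd2 & B2).
  destruct (cont_inf_lap n V f Hf z Vz e He0) as (d3 & Hd3 & B3).
  assert (N : exists d4, 0 < d4 /\ forall y, V y -> dist_n n z y < d4 -> bd y ->
    0 < dnormal n rho f y).
  { destruct (cl_cases z Hz) as [Oz|Bz].
    - destruct (proj2 Om_open z Oz) as (d4 & Hd4 & B4). exists d4. split; [easy|].
      intros y Vy D [C NO]. exfalso. apply NO, B4; auto. apply C.
    - specialize (Hn Bz). apply (dnormal_pos_iff f z Bz) in Hn.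
      assert (CD : cont_on n V (fun x => dot n (grad n rho x) (grad n f x))).
      { apply cont_dot_grad; [|now apply Ck_1_of_2].
        apply Ck_subset with (InRn n); [apply OV|apply rho_C1]. }
      destruct (CD z Vz _ Hn) as (d4 & Hd4 & B4). exists d4. split; [easy|].
      intros y Vy D By. apply dnormal_pos_iff; [easy|].
      specialize (B4 y Vy D). apply Rabs_def2 in B4. lra. }
  destruct N as (d4 & Hd4 & B4).
  set (d := Rmin (Rmin (Rmin d0 d1) (Rmin d2 d3)) (Rmin d4 (e / 2))).
  assert (0 < d) by (unfold d; repeat apply Rmin_pos; lra).
  assert (d <= d0 /\ d <= d1 /\ d <= d2 /\ d <= d3 /\ d <= d4 /\ d <= e / 2) as
    (L0 & L1 & L2 & L3 & L4 & L5).
  { unfold d, Rmin. repeat destruct Rle_dec; repeat split; lra. }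
  exists d. split; [easy|]. split.
  - intros y Iy D. apply B0; [easy|lra].
  - intros y Vy D. split.
    + intros s Hs. specialize (B1 y Vy ltac:(lra)). specialize (B2 y Vy ltac:(lra)).
      specialize (B3 y Vy ltac:(lra)). apply Hop; auto.
      replace (f y + s - f z) with ((f y - f z) + s) by ring.
      eapply Rle_lt_trans; [apply Rabs_triang|lra].
    + intros By. apply B4; auto. lra.
Qed.

Lemma strict_super_near Lam V z f : 0 <= Lam -> test_domain V -> V z -> cl z -> Ck n 2 V f ->
  Eval n Lam f z < 0 -> (bd z -> dnormal n rho f z < 0) ->
  exists d, 0 < d /\ (forall y, InRn n y -> dist_n n z y < d -> V y) /\
    forall y, V y -> dist_n n z y < d ->
      (forall s, Rabs s < d ->
        Eop Lam (f y + s) (norm_n n (fun i => Dp f i y)) (inf_lap n f y) < 0) /\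
      (bd y -> dnormal n rho f y < 0).
Proof.
  intros HL HV Vz Hz Hf He Hn. assert (OV : open_set_n n V) by apply HV.
  destruct (strict_sub_near Lam V z (fun x => - f x)) as (d & Hd & B & N);
    auto using Ck2_opp.
  - rewrite (Eval_opp n V) by easy. lra.
  - intros Bz. rewrite (dnormal_opp n V) by easy. specialize (Hn Bz). lra.
  - exists d. split; [easy|]. split; [easy|]. intros y Vy D.
    destruct (N y Vy D) as [N1 N2].
    rewrite (norm_grad_opp n V), (inf_lap_opp n V) in N1 by easy.
    rewrite (dnormal_opp n V) in N2 by easy. split.
    + intros s Hs. specialize (N1 (- s)). rewrite Rabs_Ropp in N1. specialize (N1 Hs).
      replace (- f y + - s) with (- (f y + s)) in N1 by ring.
      rewrite Eop_opp in N1. lra.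
    + intros By. specialize (N2 By). lra.
Qed.

(** If a test function fails at [z], so does its strict version [g] in a whole neighbourhood. Some
    [v] in [S] nearly attains [u z]; a slightly raised [g] touches this [v] from below near [z],
    contradicting that [v] is a supersolution. *)
Lemma super_of_infimum Lam (S : (pt -> R) -> Prop) u : 0 <= Lam ->
  cont_on n cl u ->
  (forall v, S v -> visc_super n Om rho Lam v /\ cont_on n cl v) ->
  (forall v x, S v -> cl x -> u x <= v x) ->
  (forall x eps, cl x -> 0 < eps -> exists v, S v /\ v x < u x + eps) ->
  visc_super n Om rho Lam u.
Proof.
  intros HL Hu HS Hle Happ. apply super_intro; [now apply cont_lsc|].
  intros V z f HV Vz Hz Hf E T Hn. apply Rnot_lt_le. intros He.
  assert (OV : open_set_n n V) by apply HV.
  set (g := fun x => f x + rad n z 0 0 (-1) 0 x).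
  assert (Hg : Ck n 2 V g) by (apply Ck2_plus; auto using Ck2_rad).
  assert (J : same_jet n g f z) by (apply (same_jet_plus_quartic n V); auto).
  assert (gz : g z = f z) by (unfold g; rewrite rad_at_center; ring).
  destruct (strict_super_near Lam V z g) as (d & Hd & B & N); auto.
  { now rewrite (same_jet_Eval n Lam g f z J gz). }
  { intros Bz. rewrite (same_jet_dnormal _ _ _ _ _ J). auto. }
  set (r := d / 2). assert (Hr : 0 < r < d) by (unfold r; lra).
  (* The shift [m] will satisfy [m < eps]: being less than [r ^ 4] keeps [g + m] below [v] outside
     the ball, and being less than [d] makes it admissible in [strict_super_near]. *)
  set (eps := Rmin (r ^ 4) d).
  assert (Heps : 0 < eps) by (apply Rmin_pos; [apply pow_lt|]; lra).
  assert (eps <= r ^ 4) by apply Rmin_l. assert (eps <= d) by apply Rmin_r.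
  destruct (Happ z eps Hz Heps) as (v & Sv & Hv).
  destruct (HS v Sv) as [Hsup Hcv].
  set (K := fun x => cl x /\ dist_n n z x <= r).
  assert (KV : forall x, K x -> V x).
  { intros x [Cx Dx]. apply B; [apply Cx|lra]. }
  assert (Kz : K z) by (split; [easy|rewrite dist_self; lra]).
  destruct (min_attained n K (fun x => v x + - g x)) as (y & Ky & Hmin).
  - apply closure_inter_ball_closed.
  - apply bounded_subset with cl; [now intros x [Hx _]|now apply closure_bounded].
  - eauto.
  - apply (cont_on_plus n K v).
    + apply cont_on_subset with cl; [now intros x [Hx _]|easy].
    + apply cont_on_opp, cont_on_subset with V; [easy|apply Hg].
  - assert (Vy := KV y Ky). destruct Ky as [Cy Dy].
    assert (Gle : forall x, cl x -> V x -> g x + dist_n n x z ^ 4 <= v x).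
    { intros x Cx Vx. specialize (T x Cx Vx). specialize (Hle v x Sv Cx).
      unfold g, rad, cubic. rewrite sqd_dist. lra. }
    set (m := v y - g y).
    assert (m1 : 0 <= m).
    { specialize (Gle y Cy Vy). pose proof (dist_nonneg n y z).
      pose proof (pow_le (dist_n n y z) 4 ltac:(easy)). unfold m. lra. }
    assert (m2 : m < eps) by (specialize (Hmin z Kz); unfold m; lra).
    set (g' := fun x => g x + rad n y m 0 0 0 x).
    assert (J' : same_jet n g' g y) by (apply (same_jet_plus_const n V); auto).
    assert (g'y : g' y = g y + m) by (unfold g'; now rewrite rad_at_center).
    destruct (N y Vy ltac:(lra)) as [N1 N2].
    assert (P : 0 <= Eval n Lam g' y).
    { apply (super_nonstrict Lam v V); auto.
      - apply Ck2_plus; auto using Ck2_rad.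
      - rewrite g'y. unfold m. ring.
      - intros x Cx Vx.
        replace (g' x) with (g x + m) by (unfold g', rad, cubic; ring).
        destruct (Rle_lt_dec (dist_n n z x) r) as [Dx|Dx].
        + specialize (Hmin x (conj Cx Dx)). unfold m. lra.
        + specialize (Gle x Cx Vx). rewrite dist_sym in Gle.
          pose proof (pow_incr r (dist_n n z x) 4 ltac:(lra)). lra.
      - intros By. rewrite (same_jet_dnormal _ _ _ _ _ J'). auto. }
    specialize (N1 m). rewrite Rabs_pos_eq in N1 by easy. specialize (N1 ltac:(lra)).
    unfold Eval in P. rewrite g'y, (same_jet_norm _ _ _ _ J'), (same_jet_inf_lap _ _ _ _ J') in P.
    lra.
Qed.

Lemma lipschitz_of_grad_bound L V f (K : pt -> Prop) : 0 <= L -> open_set_n n V -> Ck n 1 V f ->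
  convex_set_n K -> (forall x, K x -> V x) ->
  (forall x, K x -> norm_n n (fun i => Dp f i x) <= L) ->
  forall x y, K x -> K y -> f x - f y <= L * dist_n n x y.
Proof.
  intros HL OV Hf HK KV HG x y Kx Ky. set (p := vsub x y).
  assert (Hp : InRn n p) by (apply InRn_vsub; apply OV; auto).
  assert (HKt : forall t, 0 <= t <= 1 -> K (line y p t)) by (intros; now apply convex_line).
  destruct (MVT_cor2 (fun t => f (line y p t)) (fun t => dot n (grad n f (line y p t)) p) 0 1)
    as (t & Et & Bt); [lra| |].
  - intros t Bt. apply directional_derivative_at with V; auto.
  - rewrite line_0 in Et. unfold p at 1 in Et. rewrite line_1 in Et.
    pose proof (cauchy_schwarz n (grad n f (line y p t)) p) as C.
    rewrite norm_grad in C. specialize (HG _ (HKt t ltac:(lra))).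
    change (norm_n n p) with (dist_n n x y) in C.
    pose proof (dist_nonneg n x y). nra.
Qed.

(* Perron's bump: a supersolution that fails to be a subsolution at [z] can be lowered
   near [z]; since the test function has slope less than [L] at [z], the Lipschitz
   constant [L] survives. *)
Lemma perron_bump Lam L u V z f delta : 0 <= Lam -> 0 <= L ->
  (forall x y, cl x -> cl y -> Rabs (u x - u y) <= L * dist_n n x y) ->
  visc_super n Om rho Lam u ->
  test_domain V -> V z -> cl z -> Ck n 2 V f -> f z = u z ->
  (forall x, cl x -> V x -> u x <= f x) ->
  0 < Eval n Lam f z -> (bd z -> 0 < dnormal n rho f z) ->
  norm_n n (fun i => Dp f i z) < L -> 0 < delta ->
  exists w, (forall x y, cl x -> cl y -> Rabs (w x - w y) <= L * dist_n n x y) /\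
    visc_super n Om rho Lam w /\ w z < u z /\
    forall x, cl x -> delta <= dist_n n z x -> w x = u x.
Proof.
  intros HLam HL Hu Hsup HV Vz Hz Hf E T He Hn Hgr Hdel.
  assert (OV : open_set_n n V) by apply HV.
  set (g := fun x => f x + rad n z 0 0 1 0 x).
  assert (Hg : Ck n 2 V g) by (apply Ck2_plus; auto using Ck2_rad).
  assert (J : same_jet n g f z) by (apply (same_jet_plus_quartic n V); auto).
  assert (gz : g z = f z) by (unfold g; rewrite rad_at_center; ring).
  destruct (strict_sub_near Lam V z g) as (d & Hd & B & N); auto.
  { now rewrite (same_jet_Eval n Lam g f z J gz). }
  { intros Bz. rewrite (same_jet_dnormal _ _ _ _ _ J). auto. }
  rewrite <- (same_jet_norm _ _ _ _ J) in Hgr.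
  destruct (cont_norm_grad n V g (Ck_1_of_2 _ _ _ Hg) z Vz
    (L - norm_n n (fun i => Dp g i z)) ltac:(lra)) as (d' & Hd' & B').
  set (r := Rmin (Rmin d d') delta / 2).
  assert (Hr : 0 < r /\ r < d /\ r < d' /\ r < delta).
  { assert (0 < Rmin (Rmin d d') delta) by (repeat apply Rmin_pos; lra).
    pose proof (Rmin_l (Rmin d d') delta). pose proof (Rmin_r (Rmin d d') delta).
    pose proof (Rmin_l d d'). pose proof (Rmin_r d d'). unfold r. lra. }
  destruct Hr as (Hr & Hrd & Hrd' & Hrdel).
  (* [eps <= r ^ 4] keeps the lowered function [psi] above [u] on the sphere of radius [r], and
     [eps < d] makes the shift admissible in [strict_sub_near]. *)
  set (eps := Rmin (r ^ 4) d / 2).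
  assert (Heps : 0 < eps /\ eps <= r ^ 4 /\ eps < d).
  { assert (0 < Rmin (r ^ 4) d) by (apply Rmin_pos; [now apply pow_lt|easy]).
    pose proof (Rmin_l (r ^ 4) d). pose proof (Rmin_r (r ^ 4) d). unfold eps. lra. }
  destruct Heps as (Heps & Heps4 & Hepsd).
  set (psi := fun x => g x + rad n z (- eps) 0 0 0 x).
  assert (Epsi : forall x, psi x = g x + - eps) by (intros; unfold psi, rad, cubic; ring).
  assert (Hpsi : Ck n 2 V psi) by (apply Ck2_plus; auto using Ck2_rad).
  assert (Jp : forall x, V x -> same_jet n psi g x)
    by (intros; now apply (same_jet_plus_const n V)).
  set (K := fun x => cl x /\ dist_n n z x <= r).
  assert (KV : forall x, K x -> V x) by (intros x [Cx Dx]; apply B; [apply Cx|lra]).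
  assert (KC : convex_set_n K).
  { intros x y t [Cx Dx] [Cy Dy] Ht. split.
    - apply closure_convex; auto.
    - pose proof (dist_line_convex n z x y t Ht) as Q. unfold line, vsub in Q. nra. }
  assert (Kpsi : forall x y, K x -> K y -> psi x - psi y <= L * dist_n n x y).
  { apply (lipschitz_of_grad_bound L V psi K); auto using Ck_1_of_2.
    intros x Kx. rewrite (same_jet_norm _ _ _ _ (Jp x (KV x Kx))).
    assert (Vx := KV x Kx). destruct Kx as [Cx Dx].
    specialize (B' x Vx ltac:(lra)). apply Rabs_def2 in B'. lra. }
  assert (psi_sphere : forall x, K x -> r <= dist_n n z x -> u x <= psi x).
  { intros x Kx Dx. assert (Vx := KV x Kx). destruct Kx as [Cx _]. specialize (T x Cx Vx).
    rewrite Epsi. unfold g, rad, cubic. rewrite sqd_dist, dist_sym.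
    pose proof (pow_incr r (dist_n n z x) 4 ltac:(lra)). nra. }
  set (w := fun x => if Rlt_dec (dist_n n z x) r then Rmin (u x) (psi x) else u x).
  assert (w_le : forall x, w x <= u x).
  { intros x. unfold w. destruct Rlt_dec; [apply Rmin_l|lra]. }
  assert (w_psi : forall x, K x -> w x <= psi x).
  { intros x Kx. unfold w. destruct Rlt_dec as [l|l]; [apply Rmin_r|].
    apply psi_sphere; [easy|lra]. }
  assert (w_cases : forall x, cl x -> w x = u x \/ dist_n n z x < r /\ w x = psi x).
  { intros x Cx. unfold w. destruct Rlt_dec; [|now left].
    unfold Rmin. destruct Rle_dec; [now left|now right]. }
  assert (w_lip1 : forall x y, cl x -> cl y -> w x - w y <= L * dist_n n x y).
  { intros x y Cx Cy. destruct (w_cases y Cy) as [Ey|[Dy Ey]].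
    - specialize (Hu x y Cx Cy). specialize (w_le x).
      pose proof (Rle_abs (u x - u y)). lra.
    - assert (Ky : K y) by (split; [easy|lra]).
      destruct (Rle_lt_dec (dist_n n z x) r) as [Dx|Dx].
      + assert (Kx : K x) by now split. specialize (w_psi x Kx).
        specialize (Kpsi x y Kx Ky). lra.
      (* The segment is cut at the sphere, where [u <= psi]; the bound for [u] on the outer piece
         and that for [psi] on the inner piece add up to [L] times the whole length. *)
      + destruct (segment_meets_sphere n z x y r) as (t & Ht & Et); [lra|lra|].
        set (x' := line y (vsub x y) t) in *.
        assert (Cx' : cl x') by (apply convex_line; auto using closure_convex).
        assert (Kx' : K x') by (split; [easy|lra]).
        specialize (psi_sphere x' Kx' ltac:(lra)). specialize (Kpsi x' y Kx' Ky).
        specialize (Hu x x' Cx Cx'). pose proof (Rle_abs (u x - u x')).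
        assert (E1 : dist_n n x' y = t * dist_n n x y).
        { rewrite dist_sym. unfold x'. rewrite dist_line, Rabs_pos_eq by lra. reflexivity. }
        assert (E2 : dist_n n x x' = (1 - t) * dist_n n x y).
        { rewrite <- (line_1 y x) at 1. unfold x'. rewrite dist_line_line, Rabs_pos_eq by lra.
          reflexivity. }
        rewrite E1 in Kpsi. rewrite E2 in Hu. specialize (w_le x). nra. }
  assert (w_lip : forall x y, cl x -> cl y -> Rabs (w x - w y) <= L * dist_n n x y).
  { intros x y Cx Cy. apply Rabs_le. pose proof (w_lip1 x y Cx Cy) as W1.
    pose proof (w_lip1 y x Cy Cx) as W2. rewrite (dist_sym n y x) in W2. lra. }
  exists w. split; [easy|]. split; [|split].
  - apply super_intro; [now apply cont_lsc, (lipschitz_cont L)|].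
    intros V' y eta HV' Vy' Cy Heta Ey Te Hny.
    (* A test function below [w] touches from below either [u], a supersolution, or [psi], whose
       operator is strictly positive near [z]. *)
    destruct (w_cases y Cy) as [Ew|[Dy Ew]].
    { apply (super_nonstrict Lam u V'); auto; [congruence|].
      intros x Cx Vx. specialize (Te x Cx Vx). specialize (w_le x). lra. }
    assert (Ky : K y) by (split; [easy|lra]). assert (Vy := KV y Ky).
    destruct (N y Vy ltac:(lra)) as [N1 N2].
    assert (Epe : eta y = psi y) by congruence.
    assert (Le : forall x, Om x -> dist_n n y x < r - dist_n n z y -> eta x <= psi x).
    { intros x Ox Dx. pose proof (dist_triangle n z y x).
      eapply Rle_trans; [apply Te; [now apply Om_cl|now apply HV']|].
      apply w_psi. split; [now apply Om_cl|lra]. }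
    destruct (cl_cases y Cy) as [Oy|By].
    + apply Rle_trans with (Eval n Lam psi y).
      * unfold Eval. rewrite Epsi, (same_jet_norm _ _ _ _ (Jp y Vy)),
          (same_jet_inf_lap _ _ _ _ (Jp y Vy)).
        apply Rlt_le, N1. rewrite Rabs_Ropp, Rabs_pos_eq; lra.
      * apply (touching_interior Lam V' V eta psi y (r - dist_n n z y)); auto. lra.
    (* [eta] would increase along the inward normal while [psi], which lies above it near [y],
       decreases. *)
    + exfalso. specialize (Hny By). specialize (N2 By).
      rewrite <- (same_jet_dnormal _ _ _ _ _ (Jp y Vy)) in N2.
      apply (dnormal_pos_iff psi y By) in N2. apply (dnormal_neg_iff eta y By) in Hny.
      destruct (inward_normal_line y By) as (Ip & Ep & Dp' & _).
      set (p := fun i => -1 * grad n rho y i) in *.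
      assert (Q : dot n (grad n eta y) p <= dot n (grad n psi y) p).
      { apply (touching_directional V' V eta psi y p (r - dist_n n z y));
          auto using Ck_1_of_2. lra. }
      rewrite !Ep in Q. lra.
  - unfold w. rewrite dist_self. destruct Rlt_dec; [|lra].
    eapply Rle_lt_trans; [apply Rmin_r|]. rewrite Epsi, gz, E. lra.
  - intros x Cx Dx. unfold w. destruct Rlt_dec; [lra|easy].
Qed.

(** This makes the Perron class nonempty. At [q] the value is -1 and slopes are at most [Lam]. At
    other interior points the descent towards [q] forces slope exactly [Lam], hence a nonpositive
    infinity Laplacian, and [v <= 1] settles the rest. At boundary points other than [q] convexity
    admits no test function with negative normal derivative. *)
Lemma upper_cone_super Lam q : 0 < Lam -> cl q ->
  (forall x, cl x -> Lam * dist_n n x q <= 2) ->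
  visc_super n Om rho Lam (fun x => -1 + Lam * dist_n n x q).
Proof.
  intros HLam Cq Hd. set (v := fun x => -1 + Lam * dist_n n x q).
  assert (Lip : forall x y, cl x -> cl y -> Rabs (v x - v y) <= Lam * dist_n n x y).
  { intros x y Cx Cy. unfold v.
    pose proof (dist_triangle n x y q). pose proof (dist_triangle n y x q) as T.
    rewrite (dist_sym n y x) in T. apply Rabs_le. split; nra. }
  apply super_intro; [apply cont_lsc, (lipschitz_cont Lam); [lra|exact Lip]|].
  fold v. intros V z f HV Vz Cz Hf E T Hn. assert (OV : open_set_n n V) by apply HV.
  destruct (grad_bound_below Lam v V z f ltac:(lra) Lip HV Vz Cz Hf E T Hn) as [G1 G2].
  destruct (classic (z = q)) as [->|Nq].
  { unfold Eval. rewrite E. unfold v. rewrite dist_self.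
    replace (-1 + Lam * 0) with (-1) by ring. unfold Eop.
    destruct (Rlt_dec 0 (-1)); [lra|]. destruct (Rlt_dec (-1) 0); [|lra].
    eapply Rle_trans; [|apply Rmax_l]. rewrite Rabs_left; lra. }
  set (c := dist_n n z q).
  assert (Hc : 0 < c) by (apply dist_pos; [apply Cz|apply Cq|easy]).
  destruct (cl_cases z Cz) as [Oz|Bz].
  - assert (G3 : Lam <= norm_n n (fun i => Dp f i z)).
    { set (p := vsub q z). assert (Ip : InRn n p) by (apply InRn_vsub; [apply Cq|apply Cz]).
      assert (Np : norm_n n p = c) by (unfold c; rewrite dist_sym; reflexivity).
      destruct (open_line n Om z p Om_open Oz Ip) as (tau & Ht & Hl).
      assert (D : dot n (grad n f z) p <= - (Lam * c)).
      { apply (right_derivative_le (fun t => f (line z p t)) _ _ (Rmin tau 1)).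
        - apply Rmin_pos; lra.
        - apply directional_derivative with V; auto using Ck_1_of_2.
        - intros t [B1 B2]. pose proof (Rmin_l tau 1). pose proof (Rmin_r tau 1).
          assert (O : Om (line z p t)) by (apply Hl; rewrite Rabs_pos_eq; lra).
          specialize (T _ (Om_cl _ O) (proj1 (proj2 HV) _ O)).
          rewrite line_0, E. unfold v in *.
          assert (D : dist_n n (line z p t) q = (1 - t) * c).
          { rewrite dist_sym. rewrite <- (line_1 z q) at 1. fold p.
            rewrite dist_line_line, Rabs_pos_eq by lra. now rewrite Np. }
          rewrite D in T. fold c. lra. }
      pose proof (cauchy_schwarz n (grad n f z) (fun i => -1 * p i)) as C.
      rewrite norm_scal, Rabs_left, Np, norm_grad in C by lra.
      replace (dot n (grad n f z) (fun i => -1 * p i)) with (- dot n (grad n f z) p) in C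
        by (unfold dot; rewrite <- sumR_opp; apply sumR_ext; intros; ring).
      nra. }
    assert (G4 : norm_n n (fun i => Dp f i z) = Lam) by lra. specialize (G2 G4).
    unfold Eval. rewrite G4, E. specialize (Hd z Cz). fold c in Hd.
    unfold Eop, v. fold c.
    destruct Rlt_dec as [l|l]; [|destruct Rlt_dec; [|lra]].
    + apply Rmin_glb; [|lra]. rewrite Rabs_pos_eq by lra. nra.
    + eapply Rle_trans; [|apply Rmax_r]. lra.
  - exfalso. specialize (Hn Bz). apply (dnormal_neg_iff f z Bz) in Hn.
    destruct (inward_normal_line z Bz) as (Ip & Ep & _ & tau & Ht & Hl).
    set (p := fun i => -1 * grad n rho z i) in *.
    set (l := dot n (grad n f z) p).
    assert (Hlp : 0 < l) by (unfold l; rewrite Ep; lra).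
    (* Along the inward normal [p] the squared distance to [q] is at most [c^2 + t^2 * N], since
       [z - q] does not point inward. For [t < s] the distance is then at most [c + t * e], so the
       cone grows at rate at most [Lam * e = l / 2], less than the slope [l] of [f]. *)
    set (e := l / (2 * Lam)).
    assert (He : 0 < e) by (apply Rdiv_lt_0_compat; lra).
    assert (Ee : Lam * e = l / 2) by (unfold e; field; lra).
    set (N := dot n p p). assert (HN : 0 <= N) by apply dot_nonneg.
    set (s := 2 * c * e / (N + 1)).
    assert (Hs : 0 < s) by (apply Rdiv_lt_0_compat; nra).
    assert (Es : s * (N + 1) = 2 * c * e) by (unfold s; field; lra).
    assert (l <= Lam * e); [|lra].
    apply (right_derivative_le (fun t => f (line z p t)) _ _ (Rmin tau s)).
    + now apply Rmin_pos.
    + apply directional_derivative with V; auto using Ck_1_of_2.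
    + intros t [B1 B2]. pose proof (Rmin_l tau s). pose proof (Rmin_r tau s).
      specialize (Hl t ltac:(lra)).
      specialize (T _ (Om_cl _ Hl) (proj1 (proj2 HV) _ Hl)).
      rewrite line_0, E. unfold v in *. fold c.
      assert (D : dist_n n (line z p t) q <= c + t * e).
      { apply Rsqr_incr_0_var; [|nra]. unfold Rsqr.
        rewrite <- sqd_dist, sqd_line, sqd_dist. fold c N.
        assert (dot n (vsub z q) p <= 0).
        { rewrite Ep. pose proof (normal_nonpos z q Bz Cq) as P.
          rewrite dot_sym, dot_vsub in P. rewrite dot_sym, dot_vsub. lra. }
        assert (t * N <= 2 * c * e) by nra.
        assert (0 <= t * e * (t * e)) by nra. nra. }
      nra.
Qed.

(** Otherwise the segment from [p] could be prolonged beyond [q] inside [Om], exceeding the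
    diameter. *)
Lemma diam_point_boundary p q : cl p -> cl q -> dist_n n p q = diam_n n Om -> 0 < diam_n n Om -> bd q.
Proof.
  intros Cp Cq D Dp. split; [easy|]. intros Oq.
  set (e := vsub q p). assert (Ie : InRn n e) by (apply InRn_vsub; [apply Cq|apply Cp]).
  destruct (open_line n Om q e Om_open Oq Ie) as (tau & Ht & Hl).
  specialize (Hl (tau / 2) ltac:(rewrite Rabs_pos_eq; lra)).
  pose proof (dist_closure_le_diam n Om p _ Om_nonempty Om_bounded Cp (Om_cl _ Hl)) as H.
  assert (F : dist_n n p (line q e (tau / 2)) = (1 + tau / 2) * diam_n n Om).
  { rewrite <- D, <- (line_1 p q) at 1. fold e. rewrite line_line, dist_line, Rabs_pos_eq by lra.
    f_equal. unfold e. rewrite dist_sym. reflexivity. }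
  rewrite F in H. nra.
Qed.

Lemma perron_solution : (1 <= n)%nat ->
  exists u, visc_sol n Om rho (2 / diam_n n Om) u /\ nonconstant_on cl u /\ lipschitz_on n cl u.
Proof.
  intros Hn1. pose proof (diam_pos n Om Hn1 Om_nonempty Om_open Om_bounded) as DP.
  set (Lam := 2 / diam_n n Om).
  assert (HLam : 0 < Lam) by (apply Rdiv_lt_0_compat; lra).
  assert (HLD : Lam * diam_n n Om = 2) by (unfold Lam; field; lra).
  destruct (diam_attained n Om Om_nonempty (proj1 Om_open) Om_bounded) as (p & q & Cp & Cq & Dpq).
  assert (HD : forall x y, cl x -> cl y -> Lam * dist_n n x y <= 2).
  { intros x y Cx Cy. pose proof (dist_closure_le_diam n Om x y Om_nonempty Om_bounded Cx Cy). nra. }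
  set (S := fun v : pt -> R =>
    (forall x y, cl x -> cl y -> Rabs (v x - v y) <= Lam * dist_n n x y) /\
    v p = 1 /\ v q = -1 /\ visc_super n Om rho Lam v).
  assert (S0 : S (fun x => -1 + Lam * dist_n n x q)).
  { split; [|split; [|split]].
    - intros x y Cx Cy. pose proof (dist_triangle n x y q). pose proof (dist_triangle n y x q) as T.
      rewrite (dist_sym n y x) in T. apply Rabs_le. split; nra.
    - rewrite Dpq. lra.
    - rewrite dist_self. ring.
    - apply upper_cone_super; auto. }
  (* Since [Lam * diam = 2], a competitor drops at most 2 below its value at [p] and rises at most 2
     above its value at [q]. *)
  assert (range : forall v x, (forall x y, cl x -> cl y -> Rabs (v x - v y) <= Lam * dist_n n x y) ->
    v p = 1 -> v q = -1 -> cl x -> -1 <= v x <= 1).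
  { intros v x Lv Vp Vq Cx. pose proof (Lv x p Cx Cp) as A. pose proof (Lv x q Cx Cq) as B.
    pose proof (HD x p Cx Cp). pose proof (HD x q Cx Cq).
    rewrite Vp in A. rewrite Vq in B.
    revert A B. unfold Rabs. repeat destruct Rcase_abs; lra. }
  (* The condition [cl x] sits under the existential so that [choice] yields a total [u],
     unspecified off the closure. The infimum is minus the supremum of the negatives. *)
  assert (I : forall x, exists m, cl x ->
    (forall v, S v -> m <= v x) /\ forall eps, 0 < eps -> exists v, S v /\ v x < m + eps).
  { intros x. destruct (classic (cl x)) as [Cx|Cx]; [|exists 0; easy].
    destruct (completeness (fun r => exists v, S v /\ r = - v x)) as [m [M1 M2]].
    - exists 1. intros r (v & (L1 & L2 & L3 & _) & ->).
      pose proof (range v x L1 L2 L3 Cx). lra.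
    - eexists. eexists. split; [exact S0|reflexivity].
    - exists (- m). intros _. split.
      + intros v Sv. assert (- v x <= m) by (apply M1; eauto). lra.
      + intros eps He. apply NNPP. intros NE.
        assert (m <= m - eps); [|lra]. apply M2. intros r (v & Sv & ->).
        apply Rnot_lt_le. intros L. apply NE. exists v. split; [easy|lra]. }
  apply choice in I. destruct I as [u Hu].
  assert (u_lip1 : forall x y, cl x -> cl y -> u x - u y <= Lam * dist_n n x y).
  { intros x y Cx Cy. apply Rnot_lt_le. intros N.
    destruct (proj2 (Hu y Cy) (u x - u y - Lam * dist_n n x y) ltac:(lra)) as (v & Sv & Hv).
    pose proof (proj1 (Hu x Cx) v Sv). destruct Sv as [Lv _]. specialize (Lv x y Cx Cy).
    pose proof (Rle_abs (v x - v y)). lra. }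
  assert (u_lip : forall x y, cl x -> cl y -> Rabs (u x - u y) <= Lam * dist_n n x y).
  { intros x y Cx Cy. apply Rabs_le. pose proof (u_lip1 x y Cx Cy) as W1.
    pose proof (u_lip1 y x Cy Cx) as W2. rewrite (dist_sym n y x) in W2. lra. }
  assert (u_at : forall x a, cl x -> (forall v, S v -> v x = a) -> u x = a).
  { intros x a Cx Ha. destruct (Hu x Cx) as [H1 H2]. apply Rle_antisym.
    - rewrite <- (Ha _ S0). exact (H1 _ S0).
    - apply Rnot_lt_le. intros N. destruct (H2 (a - u x) ltac:(lra)) as (v & Sv & Hv).
      rewrite (Ha v Sv) in Hv. lra. }
  assert (up : u p = 1) by (apply u_at; [easy|intros v (_ & H & _); exact H]).
  assert (uq : u q = -1) by (apply u_at; [easy|intros v (_ & _ & H & _); exact H]).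
  assert (u_cont : cont_on n cl u) by (apply (lipschitz_cont Lam); [lra|easy]).
  assert (u_super : visc_super n Om rho Lam u).
  { apply (super_of_infimum Lam S); auto.
    - lra.
    - intros v (Lv & _ & _ & Sv). split; [easy|]. apply (lipschitz_cont Lam); [lra|easy].
    - intros v x Sv Cx. now apply Hu.
    - intros x eps Cx He. now apply Hu. }
  assert (u_sub : visc_sub n Om rho Lam u).
  { apply sub_intro; [now apply cont_usc|].
    intros V z f HV Vz Cz Hf E T Hn. apply Rnot_lt_le. intros He.
    destruct (grad_bound_above Lam u V z f ltac:(lra) u_lip HV Vz Cz Hf E T Hn) as [G1 G2].
    (* At [p] the value is 1, and slopes of at most [Lam] make the first entry of the minimum
       nonpositive. *)
    destruct (classic (z = p)) as [->|Np].
    { unfold Eval in He. rewrite E, up in He. unfold Eop in He.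
      destruct (Rlt_dec 0 1); [|lra]. rewrite Rabs_R1 in He.
      pose proof (Rmin_l (norm_n n (fun i => Dp f i p) - Lam * 1) (- inf_lap n f p)). lra. }
    (* The global minimum -1 is attained at the boundary point [q], so no test function above [u]
       can decrease along the inward normal there. *)
    destruct (classic (z = q)) as [->|Nq].
    { assert (Bq : bd q) by (apply (diam_point_boundary p); auto).
      specialize (Hn Bq). apply (dnormal_pos_iff f q Bq) in Hn.
      destruct (inward_normal_line q Bq) as (Ie & Ee & _ & tau & Ht & Hl).
      set (e := fun i => -1 * grad n rho q i) in *.
      assert (K : - dot n (grad n f q) e <= 0); [|rewrite Ee in K; lra].
      apply (right_derivative_le (fun t => - f (line q e t)) _ _ tau Ht).
      - apply (derivable_pt_lim_opp (fun t => f (line q e t))).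
        apply directional_derivative with V; auto using Ck_1_of_2. apply HV.
      - intros t B. specialize (Hl t B).
        specialize (T _ (Om_cl _ Hl) (proj1 (proj2 HV) _ Hl)).
        pose proof (range u _ u_lip up uq (Om_cl _ Hl)). rewrite line_0, E, uq. lra. }
    (* Slope exactly [Lam] would come with a nonnegative infinity Laplacian, and then [|u z| <= 1]
       would make [Eop] nonpositive for every sign of [u z]. *)
    assert (G3 : norm_n n (fun i => Dp f i z) < Lam).
    { destruct G1 as [G1|G1]; [easy|]. specialize (G2 G1). exfalso.
      unfold Eval in He. rewrite G1, E in He. unfold Eop in He.
      pose proof (range u z u_lip up uq Cz).
      destruct Rlt_dec; [|destruct Rlt_dec as [l|l]; [|lra]].
      - pose proof (Rmin_r (Lam - Lam * Rabs (u z)) (- inf_lap n f z)). lra.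
      - rewrite Rabs_left in He by lra.
        assert (Rmax (Lam * - u z - Lam) (- inf_lap n f z) <= 0) by (apply Rmax_lub; nra). lra. }
    assert (dp : 0 < dist_n n z p) by (apply dist_pos; [apply Cz|apply Cp|easy]).
    assert (dq : 0 < dist_n n z q) by (apply dist_pos; [apply Cz|apply Cq|easy]).
    (* The bump is kept away from [p] and [q], so the prescribed values survive and [w] remains in
       [S]. *)
    destruct (perron_bump Lam Lam u V z f (Rmin (dist_n n z p) (dist_n n z q)))
      as (w & Lw & Sw & Wz & Wfar); auto; try lra.
    { now apply Rmin_pos. }
    assert (SW : S w).
    { split; [easy|]. split; [|split; [|easy]].
      - rewrite Wfar; auto. apply Rmin_l.
      - rewrite Wfar; auto. apply Rmin_r. }
    pose proof (proj1 (Hu z Cz) w SW). lra. }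
  exists u. split; [now split|]. split.
  - exists p, q. split; [easy|]. split; [easy|]. rewrite up, uq. lra.
  - now exists Lam.
Qed.

End Domain.

Theorem theorem1 (n : nat) (Om : pt -> Prop) (rho : pt -> R) :
  (1 <= n)%nat ->
  (exists x, Om x) ->
  open_set_n n Om -> bounded_set_n n Om -> convex_set_n Om ->
  defining_function n Om rho ->
  (forall (Lam : R) (u : pt -> R), 0 <= Lam ->
     visc_sol n Om rho Lam u -> nonconstant_on (closure_n n Om) u ->
     Lam >= 2 / diam_n n Om) /\
  (exists u : pt -> R,
     visc_sol n Om rho (2 / diam_n n Om) u /\
     nonconstant_on (closure_n n Om) u /\
     lipschitz_on n (closure_n n Om) u).
Proof.
  intros Hn Hne HO HB HC Hrho. split.
  - intros Lam u HL Hu Hnc. now apply (eigenvalue_lower_bound n Om rho) with (u := u).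
  - now apply perron_solution.
Qed.
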